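(* Let $f\colon M\to M$ be an invertible measure-preserving transformation on a probability space $(M,\mathcal F,\mu)$, and let $\mathcal F_0\subset\mathcal F$ be a $\sigma$-subalgebra satisfying $f^{-1}\mathcal F_0\subset\mathcal F_0$. Let $\varphi\colon M\to\mathbb R$ be an $L^\infty$ observable with $\int\varphi\,d\mu=0$. (a) Assume that there exist constants $C>0$, $\tau>0$ and $0<\omega\leqslant1$ such that, for all $p\geqslant1$ and $n\geqslant1$, (i) $\|\mathbb E(\varphi\circ f^{-n}\mid\mathcal F_0)\|_p\leqslant Ce^{-\frac{\tau}{p}n^\omega}$; (ii) $\|\mathbb E(\varphi\circ f^{n}\mid\mathcal F_0)-\varphi\circ f^n\|_p\leqslant Ce^{-\frac{\tau}{p}n^\omega}$. Then there exists $\tau'>0$ such that $$\mathrm{LD}(\varphi,\varepsilon,n)\leqslant2\exp\{-\tau' n^{\frac{\omega}{2}}\varepsilon^\omega\}\quad\text{for all }n\geqslant1,\ \varepsilon>0.$$ (b) Assume that there exist constants $C>0$, $\beta>0$ and $p>\max\{2,2\beta\}$ such that, for all $n\geqslant1$, (i) $\|\mathbb E(\varphi\circ f^{-n}\mid\mathcal F_0)\|_p\leqslant Cn^{-\beta/p}$; (ii) $\|\mathbb E(\varphi\circ f^{n}\mid\mathcal F_0)-\varphi\circ f^n\|_p\leqslant Cn^{-\beta/p}$. Then there exists $K>0$ such that $$\mathrm{MLD}(\varphi,\varepsilon,n)\leqslant K\varepsilon^{-p}n^{-\beta}\quad\text{for all }n\geqslant1,\ \varepsilon>0.$$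
   Context: Large deviations: $\mathrm{LD}(\varphi,\varepsilon,n)=\mu\left(\left|\frac1n\sum_{j=0}^{n-1}\varphi\circ f^j-\int\varphi\,d\mu\right|>\varepsilon\right)$. Maximal large deviations: $\mathrm{MLD}(\varphi,\varepsilon,n)=\mu\left(\sup_{k\geqslant n}\left|\frac1k\sum_{j=0}^{k-1}\varphi\circ f^j-\int\varphi\,d\mu\right|>\varepsilon\right)$. $\mathbb E(\cdot\mid\mathcal F_0)$ denotes conditional expectation with respect to $\mu$, and $\|\cdot\|_p$ the $L^p(\mu)$ norm. *)

(* Defs.v *)
From HB Require Import structures.
From mathcomp Require Import all_boot all_order all_algebra.
From mathcomp Require Import all_classical all_reals all_analysis.
From mathcomp Require Import measurable_realfun.

Set Implicit Arguments.
Unset Strict Implicit.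
Unset Printing Implicit Defensive.

Import Order.TTheory GRing.Theory Num.Theory.
Import numFieldNormedType.Exports.

Local Open Scope classical_set_scope.
Local Open Scope ring_scope.

Section dynamics.
Context (d : measure_display) (M : measurableType d) (R : realType).
Variable mu : probability M R.

Definition sub_sigma_algebra_of (G : set (set M)) : Prop :=
  sigma_algebra setT G /\ G `<=` measurable.

(* finv is the inverse map of f; it then preserves mu as well. *)
Definition invertible_measure_preserving (f finv : M -> M) : Prop :=
  [/\ cancel f finv, cancel finv f,
      measurable_fun setT f, measurable_fun setT finv &
      forall A, measurable A -> mu (f @^-1` A) = mu A].

(* G is meant to be a sigma-algebra, so that g_sigma_algebraType G is M with
   G itself as its measurable sets. *)
Definition is_cond_exp (G : set (set M)) (X Y : M -> R) : Prop :=
  [/\ measurable_fun setT (Y : g_sigma_algebraType G -> R),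
      mu.-integrable setT (EFin \o Y) &
      forall A, G A ->
        (\int[mu]_(x in A) (Y x)%:E = \int[mu]_(x in A) (X x)%:E)%E].

(* A chosen version of E(X | G), defined up to a mu-null set.  It exists
   whenever X is integrable (cond_expP); otherwise the value is junk. *)
Definition cond_exp (G : set (set M)) (X : M -> R) : M -> R :=
  xget (cst 0) [set Y | is_cond_exp G X Y].

Definition birkhoff_average (f : M -> M) (phi : M -> R) (n : nat) (x : M) : R :=
  n%:R^-1 * \sum_(j < n) phi (iter j f x).

Definition deviation (f : M -> M) (phi : M -> R) (n : nat) (x : M) : R :=
  `|birkhoff_average f phi n x - \int[mu]_y phi y|.

Definition LD (f : M -> M) (phi : M -> R) (eps : R) (n : nat) : \bar R :=
  mu [set x | eps < deviation f phi n x].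

Definition MLD (f : M -> M) (phi : M -> R) (eps : R) (n : nat) : \bar R :=
  mu [set x | (eps%:E < ereal_sup
    [set (deviation f phi k x)%:E | k in [set k | (n <= k)%N]])%E].

Lemma is_cond_exp_exists (G : set (set M)) (X : M -> R) :
  sub_sigma_algebra_of G -> mu.-integrable setT (EFin \o X) ->
  exists Y, is_cond_exp G X Y.
Proof.
move=> [sG Gm] iX; pose N := g_sigma_algebraType G.
have GE : G.-sigma.-measurable = G by exact: measurable_g_measurableTypeE.
have mN (A : set N) : measurable A -> measurable (A : set M).
  by rewrite GE => /Gm.
have mid : measurable_fun setT (idfun : M -> N).
  by move=> _ B mB; rewrite setTI; exact (mN _ mB).
pose i : {mfun M >-> N} := HB.pack (idfun : M -> N)
  (@isMeasurableFun.Build _ _ M N idfun mid).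
pose muG := distribution mu i.
pose nu0 := induced_charge iX.
pose nu : {charge set N -> \bar R} := HB.pack (nu0 : set N -> \bar R)
  (isCharge.Build _ N R (nu0 : set N -> \bar R) (charge0 nu0)
     (fun A mA => fin_num_measure nu0 A (mN A mA))
     (fun F mF tF mUF => charge_semi_sigma_additive (s := nu0) F
        (fun k => mN _ (mF k)) tF (mN _ mUF))).
have nu_mu : nu `<< muG.
  apply/null_content_dominatesP => A mA muA.
  apply: null_set_integral => //; first exact (mN _ mA).
  exact: (@measurable_funS _ _ M _ setT) (measurable_int mu iX).
pose Y : N -> \bar R := Radon_Nikodym nu muG.
have fY x : Y x \is a fin_num by exact: Radon_Nikodym_fin_num.
have iY : muG.-integrable setT Y by exact: Radon_Nikodym_integrable.
have mY : measurable_fun setT Y by exact: measurable_int iY.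
have YE : EFin \o (fine \o Y) = Y by apply/funext => x /=; rewrite fineK.
have mYM : measurable_fun setT (Y : M -> \bar R).
  by have := measurableT_comp mY mid; exact: id.
have iYM : mu.-integrable setT (Y : M -> \bar R).
  apply/integrableP; split => //.
  have /integrableP[_] := iY.
  rewrite ge0_integral_pushforward//.
  exact: measurableT_comp.
exists (fine \o Y); split.
- by apply/measurable_EFinP; rewrite YE.
- by rewrite YE.
- move=> A GA; have mA : measurable (A : set N) by rewrite GE.
  under eq_integral => x _ do rewrite fineK//.
  have iYA : mu.-integrable (i @^-1` A) (Y \o i).
    by apply: integrableS iYM => //; exact: Gm.
  have := Radon_Nikodym_integral nu_mu mA.
  by rewrite integral_pushforward.
Qed.

Lemma cond_expP (G : set (set M)) (X : M -> R) :
  sub_sigma_algebra_of G -> mu.-integrable setT (EFin \o X) ->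
  is_cond_exp G X (cond_exp G X).
Proof. by move=> sG iX; exact: xgetPex (is_cond_exp_exists sG iX). Qed.

End dynamics.

(* Main.v *)
Require Import Defs.
From HB Require Import structures.
From mathcomp Require Import all_boot all_order all_algebra.
From mathcomp Require Import all_classical all_reals all_analysis.
From mathcomp Require Import measurable_realfun.
From mathcomp Require Import zify ring lra.

(** Let F_k denote the pulled back sigma-algebra f^-k F0, for k of either sign;
    these decrease with k.  Composing with iterates of f turns
    E(phi o f^-K | F0) and E(phi o f^K | F0) into E(phi | F_K) and
    E(phi | F_(-K)), so the hypotheses say that phi is nearly centred given F_K
    and nearly measurable for F_(-K), up to an error e(K) in L^p.

    Comparing the scales K and 2K, phi telescopes into pieces
      w_K = (E(phi | F_(-2K)) - E(phi | F_(-K)))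
            + (E(phi | F_K) - E(phi | F_2K)),
    each measurable for F_(-2K), centred given F_2K, and of L^p norm at most
    e(K) + e(2K).  Along every 4K-th iterate such a piece is a sequence of
    reverse martingale differences.  The inequality
      |X + Y|_p ^ 2 <= |X|_p ^ 2 + c p |Y|_p ^ 2    when E(Y | X) = 0
    ([lpnorm_rio]), with its linear dependence on p, then bounds a sum of N
    terms by sqrt(c p N) |w_K|_p, and Minkowski's inequality over the 4K residue
    classes bounds the Birkhoff sum of w_K over n steps by a multiple of
    sqrt(p n K) (e(K) + e(2K)).  Summing over dyadic scales gives
    [lpnorm_birkhoff_sum_dyadic] and, when the errors decay geometrically along
    the scales, [lpnorm_birkhoff_sum_geometric].

    For part (a), take K as first scale and p = K ^ omega as exponent.  The error
    at scale K 2^i is then at most a multiple of exp(- tau 2^(i omega)), uniformly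
    in K, so that |S_n|_p <= c sqrt(p n K) <= c K sqrt n because omega <= 1.
    Markov's inequality with K of order sqrt n * eps is the claimed stretched
    exponential bound ([deviation_of_moments]).

    For part (b), the errors are 2^(- i beta / p) and beta / p < 1/2, so the last
    scale dominates and |S_n|_p <= C n^(1 - beta/p) for n a power of 2.  As
    p - beta > 1, this growth rate survives the passage to the maximum over all
    k <= 2^r, by a recursion on r ([lpnorm_dyadic_maximal]); Markov's inequality
    on each dyadic block of times k >= n leaves a geometric series of ratio
    2^(- beta) ([maximal_deviation]).

    All estimates are carried out for bounded functions: phi and the conditional
    expectations, being essentially bounded, are first replaced by bounded
    versions ([past_version], [future_version]). *)

Import Order.TTheory GRing.Theory Num.Theory.
Import numFieldNormedType.Exports.

Local Open Scope classical_set_scope.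
Local Open Scope ring_scope.

Set Implicit Arguments.
Unset Strict Implicit.
Unset Printing Implicit Defensive.

(** * Power inequalities *)

Section power_inequalities.
Context {R : realType}.
Implicit Types (a b p r s x y z M : R).

(** A convex function lies above its tangents; for powers this is Young's
    inequality with the conjugate exponents r and r / (r - 1). *)
Lemma powR_tangent r a b : 1 < r -> 0 <= a -> 0 <= b ->
  r * a `^ (r - 1) * (b - a) <= b `^ r - a `^ r.
Proof.
move=> r1 a0 b0.
have r0 : 0 < r by lra.
have rp : 0 < r - 1 by lra.
have rn0 : r != 0 by rewrite gt_eqF.
have rpn0 : r - 1 != 0 by rewrite gt_eqF.
have q0 : 0 < r / (r - 1) by rewrite divr_gt0.
have := @conjugate_powR _ b (a `^ (r - 1)) r (r / (r - 1)) b0 (powR_ge0 _ _) r0 q0.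
have -> : r^-1 + (r / (r - 1))^-1 = 1 by field; rewrite rn0 rpn0.
move=> /(_ erefl); rewrite -powRrM.
have -> : (r - 1) * (r / (r - 1)) = r by field.
move=> H.
have : r * (b * a `^ (r - 1)) <= b `^ r + (r - 1) * a `^ r.
  rewrite -(ler_pM2l r0) in H; apply: (le_trans H).
  by rewrite le_eqVlt; apply/orP; left; apply/eqP; field; rewrite rn0 rpn0.
have := mulr_powRB1 a0 r0.
set u := a `^ (r - 1); move=> <-; nra.
Qed.

(** The derivative of |x| ^ p is p times this function. *)
Definition duality_map p x : R := x * `|x| `^ (p - 2).

Lemma norm_duality_map p x : 2 < p -> `|duality_map p x| = `|x| `^ (p - 1).
Proof.
move=> p2; rewrite /duality_map normrM [X in _ * X]ger0_norm ?powR_ge0//.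
have -> : p - 2 = (p - 1) - 1 by ring.
by rewrite mulr_powRB1//; lra.
Qed.

(** The two factors are varied one at a time.  Varying x costs 1, and varying
    the power costs p - 1 by the tangent inequality for the power p - 1; their
    sum p replaces the optimal constant p - 1. *)
Lemma duality_map_lipschitz p x y M : 2 < p -> `|x| <= M -> `|y| <= M ->
  `|duality_map p x - duality_map p y| <= p * M `^ (p - 2) * `|x - y|.
Proof.
move=> p2 xM yM; set s := p - 2; have s0 : 0 < s by rewrite /s; lra.
have M0 : 0 <= M by exact: le_trans yM.
have mon (z : R) : `|z| <= M -> `|z| `^ s <= M `^ s.
  by move=> zM; rewrite ge0_ler_powR ?nnegrE// ltW.
have -> : duality_map p x - duality_map p y =
    (x - y) * `|x| `^ s + y * (`|x| `^ s - `|y| `^ s).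
  by rewrite /duality_map -/s; ring.
apply: (le_trans (ler_normD _ _)); rewrite !normrM.
rewrite (ger0_norm (powR_ge0 `|x| s)).
have nxy : `| `|x| - `|y| | <= `|x - y| by exact: ler_dist_dist.
suff : `|y| * `| `|x| `^ s - `|y| `^ s| <= (p - 1) * M `^ s * `|x - y|.
  have := mon _ xM; have := normr_ge0 (x - y); nra.
have Ms0 := powR_ge0 M s.
have s1 : 1 < s + 1 by lra.
have HA := @powR_tangent (s + 1) `|x| `|y| s1 (normr_ge0 _) (normr_ge0 _).
have HB := @powR_tangent (s + 1) `|y| `|x| s1 (normr_ge0 _) (normr_ge0 _).
have ex (z : R) : `|z| `^ (s + 1) = `|z| * `|z| `^ s.
  by rewrite -[in RHS](addrK 1 s) mulr_powRB1//; lra.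
rewrite !ex addrK in HA HB.
have x0 := normr_ge0 x; have y0 := normr_ge0 y.
have -> : p - 1 = s + 1 by rewrite /s; ring.
have [xy|xy] := lerP `|y| `|x|.
  have D : `|y| `^ s <= `|x| `^ s by rewrite ge0_ler_powR ?nnegrE// ltW.
  rewrite (@ger0_norm _ (`|x| `^ s - _)) ?subr_ge0//.
  rewrite (@ger0_norm _ (`|x| - _)) ?subr_ge0// in nxy.
  apply: (@le_trans _ _ (s * `|x| `^ s * (`|x| - `|y|))).
    by move: HA; lra.
  have := mon _ xM; have := powR_ge0 `|x| s; move=> h1 h2.
  apply: ler_pM => //; [nra|lra|].
  apply: ler_pM => //; [lra|lra].
have D : `|x| `^ s <= `|y| `^ s by rewrite ge0_ler_powR ?nnegrE// ltW.
rewrite (@ler0_norm _ (`|x| `^ s - _)) ?subr_le0// opprB.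
rewrite (@ltr0_norm _ (`|x| - _)) ?subr_lt0// opprB in nxy.
apply: (@le_trans _ _ ((s + 1) * `|y| `^ s * (`|y| - `|x|))).
  have : 0 <= (`|y| - `|x|) * `|x| `^ s by rewrite mulr_ge0 ?powR_ge0//; lra.
  by move: HB; lra.
have := mon _ yM; have := powR_ge0 `|y| s; move=> h1 h2.
apply: ler_pM => //; [nra|lra|].
apply: ler_pM => //; lra.
Qed.

(** Second-order Taylor bound without derivatives: the tangent at x + y bounds
    the increment by p times the derivative at x + y times y, and the Lipschitz
    bound moves that derivative to x. *)
Lemma powR_taylor2 p x y : 2 < p ->
  `|x + y| `^ p <= `|x| `^ p + p * (duality_map p x * y)
    + p ^+ 2 * ((`|x| + `|y|) `^ (p - 2) * y ^+ 2).
Proof.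
move=> p2; have p0 : 0 < p by lra.
set z := x + y.
have T : p * (duality_map p z * (x - z)) <= `|x| `^ p - `|z| `^ p.
  apply: le_trans (powR_tangent _ _ _); rewrite ?normr_ge0//; last by lra.
  rewrite -mulrA ler_pM2l// mulrBr mulrBr lerB//.
    apply: (le_trans (ler_norm _)); rewrite normrM norm_duality_map//.
  rewrite /duality_map mulrAC -expr2 -real_normK ?num_real// expr2 -mulrA.
  have -> : p - 2 = (p - 1) - 1 by ring.
  by rewrite mulr_powRB1 1?mulrC//; lra.
have M1 : `|z| <= `|x| + `|y| by exact: ler_normD.
have M2 : `|x| <= `|x| + `|y| by rewrite lerDl.
have L := duality_map_lipschitz p2 M1 M2.
have zy : z - x = y by rewrite /z; ring.
rewrite zy in L.
have := ler_norm ((duality_map p z - duality_map p x) * y); rewrite normrM.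
have y0 := normr_ge0 y.
move=> H.
have : (duality_map p z - duality_map p x) * y <=
   p * (`|x| + `|y|) `^ (p - 2) * y ^+ 2.
  apply: (le_trans H); rewrite -[y ^+ 2]real_normK ?num_real// expr2 mulrA.
  by rewrite ler_wpM2r.
rewrite -(ler_pM2l p0).
have xzy : x - z = - y by rewrite /z; ring.
rewrite xzy in T; move: T; rewrite /z; set w := _ `^ (p - 2); nra.
Qed.

(** The term 2 e pays for (1 + 1/p) ^ (p/2 - 1) <= e in [powR_rio]. *)
Definition rio_constant : R := 1 + 2 * expR 1.

Lemma rio_constant_gt0 : 0 < rio_constant.
Proof. by rewrite /rio_constant; have := expR_gt0 (1 : R); lra. Qed.

(** The form in which the Taylor bound can be iterated: the p-th power of a
    norm becomes a square.  By the arithmetic-geometric inequality,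
    (x + y) ^ 2 <= (1 + 1/p) (x ^ 2 + p y ^ 2), and the factor 1 + 1/p only
    costs a constant after raising to the power p/2 - 1; the tangent of the
    power p/2 at x ^ 2 + p y ^ 2 absorbs what remains. *)
Lemma powR_rio p x y : 2 < p -> 0 <= x -> 0 <= y ->
  x `^ p + p ^+ 2 * ((x + y) `^ (p - 2) * y ^+ 2)
    <= (x ^+ 2 + rio_constant * p * y ^+ 2) `^ (p / 2).
Proof.
move=> p2 x0 y0; have p0 : 0 < p by lra.
have pn0 : p != 0 by rewrite gt_eqF.
pose W := x ^+ 2 + p * y ^+ 2.
have W0 : 0 <= W by rewrite /W; nra.
have sqr (z r : R) : 0 <= z -> (z ^+ 2) `^ (r / 2) = z `^ r.
  move=> z0; rewrite -powR_mulrn// -powRrM; congr powR.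
  by field.
have H1 : (x + y) `^ (p - 2) <= expR 1 * W `^ (p / 2 - 1).
  rewrite -sqr ?addr_ge0//.
  have -> : (p - 2) / 2 = p / 2 - 1 by field.
  apply: (@le_trans _ _ (((1 + p^-1) * W) `^ (p / 2 - 1))).
    have pi0 : 0 < p^-1 by rewrite invr_gt0.
    rewrite ge0_ler_powR ?nnegrE ?sqr_ge0 ?mulr_ge0//; [lra|lra|].
    have -> : (1 + p^-1) * W = W + p^-1 * x ^+ 2 + y ^+ 2.
      by rewrite /W; field.
    have : 0 <= p^-1 * (x - p * y) ^+ 2 by rewrite mulr_ge0 ?sqr_ge0// ltW.
    have -> : p^-1 * (x - p * y) ^+ 2 = p^-1 * x ^+ 2 - 2 * x * y + p * y ^+ 2.
      by field.
    by rewrite /W; nra.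
  have p1 : 0 <= 1 + p^-1 by rewrite addr_ge0 ?invr_ge0// ltW.
  rewrite powRM// ler_wpM2r ?powR_ge0//.
  apply: (@le_trans _ _ ((expR (p^-1)) `^ (p / 2 - 1))).
    rewrite ge0_ler_powR ?nnegrE ?expR_ge0//; first by lra.
    exact: expR_ge1Dx.
  rewrite -expRM ler_expR mulrBr mulrA mulVf//.
  have : 0 < p^-1 by rewrite invr_gt0.
  lra.
have p21 : 1 < p / 2 by lra.
pose c := 2 * expR 1 * p * y ^+ 2.
have e0 := expR_gt0 (1 : R).
have c0 : 0 <= c by rewrite /c !mulr_ge0 ?sqr_ge0 ?(ltW p0) ?(ltW e0).
have := @powR_tangent (p / 2) W (W + c) p21 W0 (addr_ge0 W0 c0).
have -> : W + c = x ^+ 2 + rio_constant * p * y ^+ 2.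
  by rewrite /W /c /rio_constant; ring.
have H2 : x `^ p <= W `^ (p / 2).
  rewrite -sqr// ge0_ler_powR ?nnegrE ?sqr_ge0//; first by lra.
  by rewrite /W lerDl mulr_ge0 ?sqr_ge0// ltW.
have -> : x ^+ 2 + rio_constant * p * y ^+ 2 - W = c.
  by rewrite /W /c /rio_constant; ring.
have H3 : p ^+ 2 * ((x + y) `^ (p - 2) * y ^+ 2) <=
   p / 2 * W `^ (p / 2 - 1) * c.
  have -> : p / 2 * W `^ (p / 2 - 1) * c =
     p ^+ 2 * (expR 1 * W `^ (p / 2 - 1) * y ^+ 2) by rewrite /c; field.
  by rewrite ler_wpM2l ?sqr_ge0// ler_wpM2r ?sqr_ge0.
lra.
Qed.

Lemma sqrt2_le : Num.sqrt 2 <= 3 / 2 :> R.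
Proof.
rewrite -(@ler_pXn2r _ 2)// ?nnegrE ?sqrtr_ge0 ?divr_ge0// sqr_sqrtr//.
by rewrite expr2; lra.
Qed.

Lemma sqrt_pow2 i : Num.sqrt (2 ^+ i) = Num.sqrt 2 ^+ i :> R.
Proof. by elim: i => [|i IH]; rewrite ?sqrtr1// !exprS sqrtrM// IH. Qed.

End power_inequalities.

(** * Bounded functions, their means and their norms *)

Definition bounded_measurable {R : realType} {d} {T : measurableType d}
    (X : T -> R) : Prop :=
  measurable_fun setT X /\ exists c : R, forall x, `|X x| <= c.

Section bounded_measurable_closure.
Context {R : realType} {d} {T : measurableType d}.
Implicit Types (X Y : T -> R) (a p : R).

Lemma bounded_measurable_cst a : bounded_measurable (fun _ : T => a).
Proof. by split; [exact: measurable_cst|exists `|a|]. Qed.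

Lemma bounded_measurableD X Y : bounded_measurable X -> bounded_measurable Y ->
  bounded_measurable (fun x => X x + Y x).
Proof.
move=> [mX [a Xa]] [mY [b Yb]]; split; first exact: measurable_funD.
by exists (a + b) => x; rewrite (le_trans (ler_normD _ _))// lerD.
Qed.

Lemma bounded_measurableN X : bounded_measurable X ->
  bounded_measurable (fun x => - X x).
Proof.
move=> [mX [a Xa]]; split; first exact: measurable_funN.
by exists a => x; rewrite normrN.
Qed.

Lemma bounded_measurableB X Y : bounded_measurable X -> bounded_measurable Y ->
  bounded_measurable (fun x => X x - Y x).
Proof. by move=> bX bY; exact: bounded_measurableD (bounded_measurableN bY). Qed.

Lemma bounded_measurableM X Y : bounded_measurable X -> bounded_measurable Y ->
  bounded_measurable (fun x => X x * Y x).
Proof.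
move=> [mX [a Xa]] [mY [b Yb]]; split; first exact: measurable_funM.
by exists (a * b) => x; rewrite normrM ler_pM.
Qed.

Lemma bounded_measurable_norm X : bounded_measurable X ->
  bounded_measurable (fun x => `|X x|).
Proof.
move=> [mX [a Xa]]; split; first exact: measurableT_comp.
by exists a => x; rewrite normr_id.
Qed.

Lemma bounded_measurable_max X Y : bounded_measurable X ->
  bounded_measurable Y -> bounded_measurable (fun x => Num.max (X x) (Y x)).
Proof.
move=> [mX [a Xa]] [mY [b Yb]]; split; first exact: measurable_maxr.
exists (Num.max a b) => x.
by case: (lerP (X x) (Y x)) => _; rewrite le_max ?Xa ?Yb ?orbT.
Qed.

Lemma bounded_measurable_powR p X : 0 <= p -> bounded_measurable X ->
  bounded_measurable (fun x => `|X x| `^ p).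
Proof.
move=> p0 [mX [a Xa]]; split.
  apply: (measurableT_comp (measurable_powR p)).
  exact: measurableT_comp.
exists (a `^ p) => x; rewrite ger0_norm ?powR_ge0//.
by rewrite ge0_ler_powR ?nnegrE// (le_trans _ (Xa x)).
Qed.

Lemma bounded_measurable_sum n (F : nat -> T -> R) :
  (forall i, bounded_measurable (F i)) ->
  bounded_measurable (fun x => \sum_(i < n) F i x).
Proof.
move=> bF; elim: n => [|n IH].
  under eq_fun do rewrite big_ord0; exact: bounded_measurable_cst.
under eq_fun do rewrite big_ord_recr/=; exact: bounded_measurableD.
Qed.

Lemma bounded_measurable_comp {d'} {T' : measurableType d'} (g : T' -> T) X :
  measurable_fun setT g -> bounded_measurable X ->
  bounded_measurable (fun x => X (g x)).
Proof.
move=> mg [mX [a Xa]]; split; first exact: (measurableT_comp mX mg).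
by exists a => x.
Qed.

Lemma bounded_measurable_duality_map p X : 2 < p -> bounded_measurable X ->
  bounded_measurable (fun x => duality_map p (X x)).
Proof.
move=> p2 bX; apply: bounded_measurableM => //.
by apply: bounded_measurable_powR => //; lra.
Qed.

Lemma bounded_measurable_indic (A : set T) : measurable A ->
  bounded_measurable (\1_A : T -> R).
Proof.
move=> mA; split; first exact: measurable_indic.
by exists 1 => x; rewrite indicE; case: (_ \in _); rewrite ?normr1 ?normr0.
Qed.

End bounded_measurable_closure.

(** Means and norms are sealed, so that comparing two of them compares the
    functions and never unfolds the integrals. *)
HB.lock Definition mean {R : realType} {d} {T : measurableType d}
    (mu : probability T R) (X : T -> R) : R := \int[mu]_x X x.

HB.lock Definition lpnorm {R : realType} {d} {T : measurableType d}
    (mu : probability T R) (p : R) (X : T -> R) : R :=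
  (mean mu (fun x => `|X x| `^ p)) `^ p^-1.

Section expectation_and_norms.
Context {R : realType} {d} {T : measurableType d}.
Variable mu : probability T R.
Implicit Types (X Y U : T -> R) (a c l p : R).

Local Notation E := (mean mu).
Local Notation lpnorm := (lpnorm mu).

Lemma bounded_measurable_integrable X : bounded_measurable X ->
  mu.-integrable setT (EFin \o X).
Proof.
move=> [mX [a Xa]]; apply: measurable_bounded_integrable => //.
  by rewrite ltey_eq fin_num_measure.
exists a; split; first exact: num_real.
by move=> b ab x _ /=; rewrite (le_trans (Xa x))// ltW.
Qed.

Lemma eq_mean X Y : X =1 Y -> E X = E Y.
Proof. by move=> /funext ->. Qed.

Lemma meanD X Y : bounded_measurable X -> bounded_measurable Y ->
  E (fun x => X x + Y x) = E X + E Y.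
Proof.
move=> bX bY; rewrite mean.unlock RintegralD//;
  exact: bounded_measurable_integrable.
Qed.

Lemma meanB X Y : bounded_measurable X -> bounded_measurable Y ->
  E (fun x => X x - Y x) = E X - E Y.
Proof.
move=> bX bY; rewrite mean.unlock RintegralB//;
  exact: bounded_measurable_integrable.
Qed.

Lemma meanZ a X : bounded_measurable X -> E (fun x => a * X x) = a * E X.
Proof.
by move=> bX; rewrite mean.unlock RintegralZl//; exact: bounded_measurable_integrable.
Qed.

Lemma mean_cst a : E (fun=> a) = a.
Proof.
rewrite mean.unlock Rintegral_cst// [X in fine X](_ : _ = 1%E) ?mulr1//.
exact: probability_setT.
Qed.

Lemma le_mean X Y : bounded_measurable X -> bounded_measurable Y ->
  (forall x, X x <= Y x) -> E X <= E Y.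
Proof.
move=> bX bY XY; rewrite mean.unlock; apply: le_Rintegral => //;
  exact: bounded_measurable_integrable.
Qed.

Lemma mean_comp (g : T -> T) X : measurable_fun setT g ->
  (forall A, measurable A -> mu (g @^-1` A) = mu A) ->
  bounded_measurable X -> E (fun x => X (g x)) = E X.
Proof.
move=> mg pg bX; rewrite mean.unlock; congr fine.
have <- := @eq_measure_integral _ _ _ setT mu (pushforward mu g) (EFin \o X).
  rewrite integral_pushforward//; first by apply/measurable_EFinP; case: bX.
  by rewrite preimage_setT; apply: bounded_measurable_integrable; exact: bounded_measurable_comp.
by move=> A mA _; rewrite /= /pushforward pg.
Qed.

Lemma lpnorm_ge0 p X : 0 <= lpnorm p X.
Proof. by rewrite lpnorm.unlock; exact: powR_ge0. Qed.

Lemma mean_powR_ge0 p X : 0 <= E (fun x => `|X x| `^ p).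
Proof. by rewrite mean.unlock; apply: Rintegral_ge0 => x _; exact: powR_ge0. Qed.

Lemma powR_lpnorm p X : 0 < p ->
  lpnorm p X `^ p = E (fun x => `|X x| `^ p).
Proof.
move=> p0; rewrite lpnorm.unlock -powRrM mulVf ?gt_eqF// powRr1//.
exact: mean_powR_ge0.
Qed.

Lemma LnormE p X : 0 < p -> bounded_measurable X ->
  'N[mu]_p%:E[EFin \o X]%E = (lpnorm p X)%:E.
Proof.
move=> p0 bX; rewrite unlock/=.
rewrite (eq_integral (fun x => (`|X x| `^ p)%:E))//.
rewrite lpnorm.unlock mean.unlock /Rintegral -poweR_EFin fineK//.
have := bounded_measurable_integrable (bounded_measurable_powR (ltW p0) bX).
exact: integrable_fin_num.
Qed.

Lemma le_lpnorm p X Y : 0 < p -> bounded_measurable X ->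
  bounded_measurable Y -> (forall x, `|X x| <= `|Y x|) ->
  lpnorm p X <= lpnorm p Y.
Proof.
move=> p0 bX bY XY.
rewrite lpnorm.unlock.
rewrite ge0_ler_powR ?nnegrE ?mean_powR_ge0 ?invr_ge0 ?(ltW p0)//.
apply: le_mean; [by apply: bounded_measurable_powR => //; exact: ltW..|].
by move=> x; rewrite ge0_ler_powR ?nnegrE// ltW.
Qed.

Lemma lpnorm_cst p c : 0 < p -> 0 <= c -> lpnorm p (fun=> c) = c.
Proof.
move=> p0 c0; rewrite lpnorm.unlock mean_cst -powRrM mulfV ?gt_eqF//.
by rewrite powRr1// ger0_norm.
Qed.

Lemma lpnorm_le_bound p X c : 0 < p -> bounded_measurable X ->
  (forall x, `|X x| <= c) -> lpnorm p X <= c.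
Proof.
move=> p0 bX Xc.
have c0 : 0 <= c by apply: le_trans (Xc point).
apply: (@le_trans _ _ (lpnorm p (fun=> c))); last by rewrite lpnorm_cst.
apply: le_lpnorm => //; first exact: bounded_measurable_cst.
by move=> x; rewrite (ger0_norm c0).
Qed.

Lemma lpnormD p X Y : 1 <= p -> bounded_measurable X ->
  bounded_measurable Y ->
  lpnorm p (fun x => X x + Y x) <= lpnorm p X + lpnorm p Y.
Proof.
move=> p1 bX bY; have p0 : 0 < p by lra.
rewrite -lee_fin EFinD -(LnormE p0 bX) -(LnormE p0 bY).
rewrite -(LnormE p0 (bounded_measurableD bX bY)).
by apply: minkowski_EFin => //; [case: bX|case: bY].
Qed.

Lemma lpnormN p X : lpnorm p (fun x => - X x) = lpnorm p X.
Proof.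
by rewrite lpnorm.unlock; congr (_ `^ _); apply: eq_mean => x; rewrite normrN.
Qed.

Lemma lpnormB p X Y : 1 <= p -> bounded_measurable X ->
  bounded_measurable Y ->
  lpnorm p (fun x => X x - Y x) <= lpnorm p X + lpnorm p Y.
Proof.
move=> p1 bX bY; rewrite -(lpnormN p Y).
by apply: lpnormD => //; exact: bounded_measurableN.
Qed.

Lemma lpnorm_norm p X : lpnorm p (fun x => `|X x|) = lpnorm p X.
Proof.
by rewrite lpnorm.unlock; congr (_ `^ _); apply: eq_mean => x; rewrite normr_id.
Qed.

Lemma lpnorm_sum p n (F : nat -> T -> R) : 1 <= p ->
  (forall i, bounded_measurable (F i)) ->
  lpnorm p (fun x => \sum_(i < n) F i x) <= \sum_(i < n) lpnorm p (F i).
Proof.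
move=> p1 bF; elim: n => [|n IH].
  under [fun x => _]eq_fun do rewrite big_ord0.
  by rewrite big_ord0 lpnorm_cst//; lra.
under [fun x => _]eq_fun do rewrite big_ord_recr/=.
rewrite big_ord_recr/=; apply: (le_trans (lpnormD p1 _ _)) => //.
  exact: bounded_measurable_sum.
by rewrite lerD2r.
Qed.

Lemma lpnorm_comp p (g : T -> T) X : 0 < p -> measurable_fun setT g ->
  (forall A, measurable A -> mu (g @^-1` A) = mu A) ->
  bounded_measurable X -> lpnorm p (fun x => X (g x)) = lpnorm p X.
Proof.
move=> p0 mg pg bX; rewrite lpnorm.unlock; congr (_ `^ _).
rewrite -(@mean_comp g (fun x => `|X x| `^ p))//.
by apply: bounded_measurable_powR => //; exact: ltW.
Qed.

Lemma lpnorm_markov p X l : 0 < p -> 0 < l -> bounded_measurable X ->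
  (mu [set x | (l < `|X x|)%R] <= ((lpnorm p X / l) `^ p)%:E)%E.
Proof.
move=> p0 l0 bX; set A := [set x | _].
have mA : measurable A.
  rewrite -[A]setTI; apply: measurable_fun_ltr => //.
  by have [] := bounded_measurable_norm bX.
have muA : mu A = (E (\1_A : T -> R))%:E.
  rewrite mean.unlock /Rintegral integral_indic// setIT fineK//.
  exact: fin_num_measure.
have bA : bounded_measurable (\1_A : T -> R) by exact: bounded_measurable_indic.
rewrite muA lee_fin powRM ?lpnorm_ge0 ?invr_ge0 ?(ltW l0)//.
rewrite -powR_inv1 ?(ltW l0)// -powRrM mulN1r powRN.
rewrite ler_pdivlMr ?powR_gt0// mulrC -meanZ// powR_lpnorm//.
apply: le_mean.
- by apply: bounded_measurableM => //; exact: bounded_measurable_cst.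
- by apply: bounded_measurable_powR => //; exact: ltW.
- move=> x; rewrite indicE.
  have [/set_mem xA|_] := boolP (x \in A); last by rewrite mulr0 powR_ge0.
  rewrite mulr1 ge0_ler_powR ?nnegrE ?normr_ge0 ?(ltW p0) ?(ltW l0)//.
  exact: ltW xA.
Qed.

(** Hoelder's inequality with exponents p / (p - 2) and p / 2. *)
Lemma lpnorm_hoelder p X Y : 2 < p -> bounded_measurable X ->
  bounded_measurable Y ->
  E (fun x => `|X x| `^ (p - 2) * Y x ^+ 2) <=
  lpnorm p X `^ (p - 2) * lpnorm p Y ^+ 2.
Proof.
move=> p2 bX bY; have p0 : 0 < p by lra.
have pm2 : 0 < p - 2 by lra.
have pn : p != 0 by rewrite gt_eqF.
have pmn : p - 2 != 0 by rewrite gt_eqF.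
set F := fun x => `|X x| `^ (p - 2); set G := fun x => Y x ^+ 2.
have bF : bounded_measurable F by exact: bounded_measurable_powR (ltW pm2) bX.
have bG : bounded_measurable G.
  by under [G]eq_fun do rewrite expr2; exact: bounded_measurableM.
have q0 : 0 < p / (p - 2) by rewrite divr_gt0.
have r0 : 0 < p / 2 by rewrite divr_gt0.
have := @hoelder _ _ _ mu F G (p / (p - 2)) (p / 2) bF.1 bG.1 q0 r0.
have -> : (p / (p - 2))^-1 + (p / 2)^-1 = 1 by field; rewrite pn pmn.
move=> /(_ erefl).
have bFG : bounded_measurable (F \* G) by exact: bounded_measurableM.
rewrite LnormE// [X in (X <= _)%E -> _](_ : _ = (lpnorm 1 (F \* G))%:E); last first.
  by rewrite -LnormE.
rewrite LnormE// -EFinM lee_fin.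
have -> : lpnorm 1 (F \* G) = E (fun x => F x * G x).
  rewrite lpnorm.unlock invr1 powRr1 ?mean_powR_ge0//; apply: eq_mean => x.
  rewrite powRr1 ?normr_ge0//= ger0_norm// mulr_ge0 ?sqr_ge0 ?powR_ge0//.
have -> : lpnorm (p / (p - 2)) F = lpnorm p X `^ (p - 2).
  rewrite lpnorm.unlock -powRrM.
  have -> : (p / (p - 2))^-1 = p^-1 * (p - 2) by field; rewrite pn pmn.
  congr (_ `^ _); apply: eq_mean => x.
  by rewrite /F ger0_norm ?powR_ge0// -powRrM; congr powR; field.
have -> : lpnorm (p / 2) G = lpnorm p Y ^+ 2.
  rewrite lpnorm.unlock -[in RHS]powR_mulrn ?powR_ge0// -powRrM.
  have -> : (p / 2)^-1 = p^-1 * 2 by field.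
  congr (_ `^ _); apply: eq_mean => x.
  by rewrite /G normrX -powR_mulrn// -powRrM; congr powR; field.
by [].
Qed.

(** The hypothesis says that Y is orthogonal to the derivative of the p-th
    power at X, so the linear term of the Taylor bound integrates to zero; this
    is where the martingale property enters.  The linear growth in p of the
    factor of the last term is what part (a) needs for omega = 1. *)
Lemma lpnorm_rio p X Y : 2 < p -> bounded_measurable X ->
  bounded_measurable Y -> E (fun x => duality_map p (X x) * Y x) = 0 ->
  lpnorm p (fun x => X x + Y x) ^+ 2 <=
  lpnorm p X ^+ 2 + rio_constant * p * lpnorm p Y ^+ 2.
Proof.
move=> p2 bX bY XY; have p0 : 0 < p by lra.
have bJ := bounded_measurable_duality_map p2 bX.
pose U x := `|X x| + `|Y x|.
have bU : bounded_measurable U.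
  by apply: bounded_measurableD; exact: bounded_measurable_norm.
have bp Z : bounded_measurable Z -> bounded_measurable (fun x => `|Z x| `^ p).
  by apply: bounded_measurable_powR; exact: ltW.
have bUY : bounded_measurable (fun x => `|U x| `^ (p - 2) * Y x ^+ 2).
  apply: bounded_measurableM; first by apply: bounded_measurable_powR bU; lra.
  by under [fun x => _]eq_fun do rewrite expr2; exact: bounded_measurableM.
have bJY := bounded_measurableM bJ bY.
have bZ (a : R) Z : bounded_measurable Z -> bounded_measurable (fun x => a * Z x).
  by move=> bZ; exact: bounded_measurableM (bounded_measurable_cst a) bZ.
have NU : lpnorm p U <= lpnorm p X + lpnorm p Y.
  apply: (le_trans (lpnormD _ _ _)); rewrite ?lpnorm_norm//; [lra|..];
    exact: bounded_measurable_norm.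
have H : E (fun x => `|X x + Y x| `^ p) <= lpnorm p X `^ p +
    p ^+ 2 * ((lpnorm p X + lpnorm p Y) `^ (p - 2) * lpnorm p Y ^+ 2).
  apply: (@le_trans _ _ (E (fun x => `|X x| `^ p + p * (duality_map p (X x) * Y x)
    + p ^+ 2 * (`|U x| `^ (p - 2) * Y x ^+ 2)))).
    apply: le_mean; first exact/bp/bounded_measurableD.
      apply: bounded_measurableD; last exact: bZ.
      by apply: bounded_measurableD; [exact: bp|exact: bZ].
    move=> x; rewrite (@ger0_norm _ (U x)) ?addr_ge0//; exact: powR_taylor2.
  rewrite meanD//; [|by apply: bounded_measurableD; [exact: bp|exact: bZ]|exact: bZ].
  rewrite meanD//; [|exact: bp|exact: bZ].
  rewrite !meanZ// XY mulr0 addr0 -powR_lpnorm// lerD2l ler_wpM2l ?sqr_ge0//.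
  apply: (le_trans (lpnorm_hoelder p2 bU bY)).
  have pm2 : 0 <= p - 2 by lra.
  rewrite ler_wpM2r ?sqr_ge0// ge0_ler_powR ?nnegrE ?lpnorm_ge0//.
  by rewrite addr_ge0 ?lpnorm_ge0.
have K0 := @rio_constant_gt0 R.
have W0 : 0 <= lpnorm p X ^+ 2 + rio_constant * p * lpnorm p Y ^+ 2.
  by rewrite addr_ge0 ?sqr_ge0// mulr_ge0 ?sqr_ge0// mulr_ge0// ltW.
have := le_trans H (powR_rio p2 (lpnorm_ge0 p X) (lpnorm_ge0 p Y)).
rewrite -powR_lpnorm// => H2.
have -> : lpnorm p (fun x => X x + Y x) ^+ 2 =
    (lpnorm p (fun x => X x + Y x) `^ p) `^ (2 / p).
  rewrite -powRrM -powR_mulrn ?lpnorm_ge0//; congr powR; field.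
  by rewrite gt_eqF.
pose W := lpnorm p X ^+ 2 + rio_constant * p * lpnorm p Y ^+ 2.
rewrite -/W in W0 H2 *.
have -> : W = (W `^ (p / 2)) `^ (2 / p).
  rewrite -powRrM (_ : p / 2 * (2 / p) = 1) ?powRr1//; field.
  by rewrite gt_eqF.
rewrite ge0_ler_powR ?nnegrE ?powR_ge0//.
by rewrite ltW// divr_gt0.
Qed.

End expectation_and_norms.

(** * Conditional expectations of bounded functions *)

Section conditional_expectation.
Context {R : realType} {d} {M : measurableType d}.
Variable mu : probability M R.
Implicit Types (G : set (set M)) (X Y : M -> R).

Local Notation E := (mean mu).

Lemma sub_sigma_measurableE G (A : set M) : sub_sigma_algebra_of G ->
  measurable (A : set (g_sigma_algebraType G)) = G A.
Proof. by move=> [sG _]; rewrite measurable_g_measurableTypeE. Qed.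

(** Measurable sets of G are measurable, so functions on the coarse space may be
    viewed on the fine one. *)
Lemma sub_sigma_measurable_fun G {d'} {T : measurableType d'} (h : M -> T) :
  sub_sigma_algebra_of G ->
  measurable_fun setT (h : g_sigma_algebraType G -> T) -> measurable_fun setT h.
Proof.
move=> sG mh _ B mB.
have := mh measurableT B mB.
by rewrite sub_sigma_measurableE// => /(proj2 sG).
Qed.

Lemma sub_sigma_bounded_measurable G X : sub_sigma_algebra_of G ->
  bounded_measurable (X : g_sigma_algebraType G -> R) -> bounded_measurable X.
Proof. by move=> sG [mX bX]; split => //; exact: sub_sigma_measurable_fun mX. Qed.

(** The sum counts the integers 1, ..., m that do not exceed t. *)
Lemma staircase_approx (m : nat) (t : R) : 0 <= t <= m%:R ->
  0 <= t - \sum_(i < m) (if i.+1%:R <= t then 1 else 0) <= 1.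
Proof.
elim: m => [|m IH] /andP[t0 tm].
  by rewrite big_ord0 subr0 t0 (le_trans tm)//.
rewrite big_ord_recr/=; have [tm'|mt] := lerP t m%:R.
  rewrite (_ : (m.+1%:R <= t) = false); last first.
    by apply/negbTE; rewrite -ltNge (le_lt_trans tm')// ltr_nat.
  by rewrite addr0; apply: IH; rewrite t0.
rewrite (eq_bigr (fun=> 1)) => [|i _]; last first.
  by rewrite (le_trans _ (ltW mt))// ler_nat ltn_ord.
rewrite sumr_const card_ord.
have m1 : m.+1%:R = m%:R + 1 :> R by rewrite -natr1.
rewrite m1 in tm *; case: ifPn => [h|]; first by lra.
by rewrite -ltNge => h; lra.
Qed.

(** From indicators to test functions: an affine change brings h into the unit
    interval, where it is within 1/m of an average of m indicators of its
    superlevel sets, and D is bounded. *)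
Lemma mean_test_function G (D h : M -> R) : sub_sigma_algebra_of G ->
  bounded_measurable D ->
  (forall A, G A -> E (fun x => D x * \1_A x) = 0) ->
  bounded_measurable (h : g_sigma_algebraType G -> R) ->
  E (fun x => D x * h x) = 0.
Proof.
move=> sG bD DA bh; have [mh [c hc]] := bh.
have [mD [b Db]] := bD.
have c0 : 0 <= c by exact: le_trans (hc point).
have b0 : 0 <= b by exact: le_trans (Db point).
have k0 : 0 < 2 * c + 1 by lra.
pose g x := (h x + c) / (2 * c + 1).
have g0 x : 0 <= g x.
  by rewrite divr_ge0 ?(ltW k0)//; have := hc x; rewrite ler_norml => /andP[]; lra.
have g1 x : g x <= 1.
  by rewrite ler_pdivrMr// mul1r; have := hc x; rewrite ler_norml => /andP[]; lra.
have bgN : bounded_measurable (g : g_sigma_algebraType G -> R).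
  apply: bounded_measurableM (bounded_measurable_cst _).
  by apply: bounded_measurableD => //; exact: bounded_measurable_cst.
have bg : bounded_measurable g by exact: sub_sigma_bounded_measurable bgN.
have bDg := bounded_measurableM bD bg.
have D0 : E D = 0.
  rewrite -(DA setT); last first.
    by rewrite -sub_sigma_measurableE.
  by apply: eq_mean => x; rewrite indicE in_setT mulr1.
have -> : E (fun x => D x * h x) = (2 * c + 1) * E (fun x => D x * g x) - c * E D.
  rewrite -meanZ// -meanZ// -meanB//; last 2 first.
  - exact: bounded_measurableM (bounded_measurable_cst _) bDg.
  - exact: bounded_measurableM (bounded_measurable_cst _) bD.
  apply: eq_mean => x; rewrite /g; field.
  by rewrite gt_eqF.
suff -> : E (fun x => D x * g x) = 0 by rewrite D0 !mulr0 subr0.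
have H (m : nat) : m%:R * `|E (fun x => D x * g x)| <= b.
  pose A i := [set x | i.+1%:R <= m%:R * g x].
  have GA i : G (A i).
    rewrite -sub_sigma_measurableE// -[A i]setTI.
    apply: (@measurable_fun_ler _ (g_sigma_algebraType G)) => //.
    exact: measurable_funM (measurable_cst _) bgN.1.
  have mA i : measurable (A i) by apply: (proj2 sG); exact: GA.
  pose F i x := D x * \1_(A i) x.
  have bF i : bounded_measurable (F i).
    exact: bounded_measurableM bD (bounded_measurable_indic (mA i)).
  pose S x := \sum_(i < m) F i x.
  have bS : bounded_measurable S by exact: bounded_measurable_sum.
  have ES : E S = 0.
    rewrite /S; elim: (m) => [|n IH].
      by under [fun x => _]eq_fun do rewrite big_ord0; rewrite mean_cst.
    under [fun x => _]eq_fun do rewrite big_ord_recr/=.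
    by rewrite meanD ?IH ?DA ?addr0//; exact: bounded_measurable_sum.
  have bZ : bounded_measurable (fun x => m%:R * (D x * g x)).
    exact: bounded_measurableM (bounded_measurable_cst _) bDg.
  have -> : m%:R * `|E (fun x => D x * g x)| =
      `|E (fun x => m%:R * (D x * g x) - S x)|.
    by rewrite meanB// ES subr0 meanZ// normrM ger0_norm.
  have bZS := bounded_measurableB bZ bS.
  apply: (@le_trans _ _ (E (fun x => `|m%:R * (D x * g x) - S x|))).
    by rewrite mean.unlock; apply: le_normr_Rintegral => //; exact: bounded_measurable_integrable.
  rewrite -[leRHS](mean_cst mu b); apply: le_mean.
  - exact: bounded_measurable_norm.
  - exact: bounded_measurable_cst.
  move=> x.
  have -> : m%:R * (D x * g x) - S x = D x *
      (m%:R * g x - \sum_(i < m) (if i.+1%:R <= m%:R * g x then 1 else 0)).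
    rewrite mulrBr mulrCA; congr (_ - _); rewrite /S mulr_sumr.
    apply: eq_bigr => i _; rewrite /F indicE; congr (_ * _).
    have -> : (x \in A i) = (i.+1%:R <= m%:R * g x).
      by apply/idP/idP => [/set_mem//|h']; rewrite inE.
    by case: ifP.
  have : 0 <= m%:R * g x <= m%:R by rewrite mulr_ge0//= ler_piMr.
  move=> /staircase_approx /andP[s0 s1].
  rewrite normrM -[b]mulr1 ler_pM//.
  by rewrite ger0_norm.
apply/eqP; rewrite -normr_eq0; apply/negP => /negP n0.
have e0 : 0 < `|E (fun x => D x * g x)| by rewrite lt0r n0 normr_ge0.
have := H (Num.truncn (b / `|E (fun x => D x * g x)|)).+1.
rewrite -ler_pdivlMr// leNgt => /negP; apply.
by apply: truncnS_gt; rewrite divr_ge0.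
Qed.

(** On the set A where Y exceeds c, which lies in G, the nonnegative function
    Y - c has the same integral as X - c, hence a zero integral. *)
Lemma ae_le_cond_exp G X Y c : sub_sigma_algebra_of G ->
  bounded_measurable X -> (forall x, X x <= c) -> is_cond_exp mu G X Y ->
  {ae mu, forall x, Y x <= c}.
Proof.
move=> sG bX Xc [mY iY YX].
pose A := [set x | c < Y x].
have GA : G A.
  rewrite -sub_sigma_measurableE// -[A]setTI.
  by apply: (@measurable_fun_ltr _ (g_sigma_algebraType G)).
have mA : measurable A by exact: (proj2 sG).
have mYM : measurable_fun setT Y := sub_sigma_measurable_fun sG mY.
have iA (Z : M -> R) : mu.-integrable setT (EFin \o Z) -> mu.-integrable A (EFin \o Z).
  by apply: integrableS.
have ic := bounded_measurable_integrable mu (bounded_measurable_cst c).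
have iX := bounded_measurable_integrable mu bX.
have H : \int[mu]_(x in A) (Y x - c) = 0.
  apply/eqP; rewrite eq_le; apply/andP; split; last first.
    by apply: Rintegral_ge0 => x Ax; rewrite subr_ge0 ltW.
  rewrite RintegralB//; [|exact: iA iY|exact: iA ic].
  have -> : \int[mu]_(x in A) Y x = \int[mu]_(x in A) X x.
    by rewrite /Rintegral YX.
  rewrite subr_le0; apply: le_Rintegral => //; [exact: iA iX|exact: iA ic].
have iYc : mu.-integrable A (EFin \o (fun x => Y x - c)).
  have := integrableB mA (iA _ iY) (iA _ ic).
  by apply: eq_integrable.
have Z0 : (\int[mu]_(x in A) `|(Y x - c)%:E| = 0)%E.
  rewrite (eq_integral (fun x => (Y x - c)%:E)) => [|x /set_mem Ax]; last first.
    by rewrite gee0_abs// lee_fin subr_ge0 ltW.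
  by rewrite -[LHS]fineK ?integrable_fin_num// -/(Rintegral _ _ _) H.
have mYc : measurable_fun A (fun x => (Y x - c)%:E).
  by case/integrableP: iYc.
have [/(_ Z0) ae0 _] := ae_eq_integral_abs mu mA mYc.
apply: filterS ae0 => x Hx; rewrite leNgt; apply/negP => cY.
by have := Hx cY => -[] /eqP; rewrite subr_eq0 gt_eqF.
Qed.

Lemma is_cond_expN G X Y : is_cond_exp mu G X Y -> 
  mu.-integrable setT (EFin \o X) -> sub_sigma_algebra_of G ->
  is_cond_exp mu G (fun x => - X x) (fun x => - Y x).
Proof.
move=> [mY iY YX] iX sG; split.
- exact: measurable_funN.
- have -> : EFin \o (fun x => - Y x) = (fun x => - (Y x)%:E)%E by [].
  exact: integrableN.
- move=> A GA; have mA : measurable A by exact: (proj2 sG).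
  have iA (Z : M -> R) : mu.-integrable setT (EFin \o Z) -> mu.-integrable A (EFin \o Z).
    by apply: integrableS.
  have oppI (Z : M -> R) : mu.-integrable setT (EFin \o Z) ->
      (\int[mu]_(x in A) (- Z x)%:E = - \int[mu]_(x in A) (Z x)%:E)%E.
    move=> /iA iZ; under eq_integral do rewrite EFinN.
    by rewrite integralN//; exact: integrable_add_def.
  by rewrite !oppI// YX.
Qed.

Lemma eq_Rintegral_ae (X Y : M -> R) A : measurable A -> measurable_fun setT X ->
  measurable_fun setT Y -> {ae mu, forall x, X x = Y x} ->
  (\int[mu]_(x in A) (X x)%:E = \int[mu]_(x in A) (Y x)%:E)%E.
Proof.
move=> mA mX mY XY; apply: ae_eq_integral => //.
- by apply: measurable_funTS; exact/measurable_EFinP.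
- by apply: measurable_funTS; exact/measurable_EFinP.
- by apply: filterS XY => x -> _.
Qed.

(** The version Y is the conditional expectation truncated at a bound of X';
    the truncation only acts on a null set. *)
Lemma bounded_cond_exp G X X' : sub_sigma_algebra_of G ->
  measurable_fun setT X -> bounded_measurable X' ->
  {ae mu, forall x, X x = X' x} ->
  exists Y : M -> R, [/\ bounded_measurable (Y : g_sigma_algebraType G -> R),
    measurable_fun setT (cond_exp mu G X),
    {ae mu, forall x, cond_exp mu G X x = Y x} &
    forall h : M -> R, bounded_measurable (h : g_sigma_algebraType G -> R) ->
      E (fun x => Y x * h x) = E (fun x => X' x * h x)].
Proof.
move=> sG mX bX' XX'.
have [mX' [c X'c]] := bX'.
have c0 : 0 <= c by exact: le_trans (X'c point).
have iX' := bounded_measurable_integrable mu bX'.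
have iX : mu.-integrable setT (EFin \o X).
  apply/integrableP; split; first exact/measurable_EFinP.
  have [_] := integrableP _ _ _ iX'; congr (_ < _)%E; apply: ae_eq_integral => //.
  - by apply: measurableT_comp => //; exact/measurable_EFinP.
  - by apply: measurableT_comp => //; exact/measurable_EFinP.
  - by apply: filterS XX' => x /= -> _.
set Y0 := cond_exp mu G X.
have C0 : is_cond_exp mu G X' Y0.
  have [mY iY YX] := cond_expP sG iX; split => // A GA; rewrite YX//.
  by apply: eq_Rintegral_ae => //; exact: (proj2 sG).
have [mY iY YX] := C0.
have mYM : measurable_fun setT Y0 := sub_sigma_measurable_fun sG mY.
pose Y x : R := Num.max (- c) (Num.min c (Y0 x)).
have bY : bounded_measurable (Y : g_sigma_algebraType G -> R).
  split.
    apply: measurable_maxr; first exact: measurable_cst.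
    by apply: measurable_minr; first exact: measurable_cst.
  exists c => x; rewrite /Y ler_norml; apply/andP; split.
    by rewrite le_max lexx.
  by rewrite ge_max ge_min lexx/= andbT; lra.
have aeY : {ae mu, forall x, Y0 x = Y x}.
  have U : {ae mu, forall x, Y0 x <= c}.
    apply: ae_le_cond_exp C0 => // x.
    by have := X'c x; rewrite ler_norml => /andP[].
  have L : {ae mu, forall x, - Y0 x <= c}.
    apply: ae_le_cond_exp (is_cond_expN C0 iX' sG) => //.
      exact: bounded_measurableN.
    by move=> x; have := X'c x; rewrite ler_norml => /andP[]; lra.
  apply: filterS2 U L => x u l.
  rewrite /Y min_r//.
  by rewrite max_r//; lra.
exists Y; split => //.
move=> h bh.
have bYM : bounded_measurable (Y : M -> R) := sub_sigma_bounded_measurable sG bY.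
have bhM : bounded_measurable (h : M -> R) := sub_sigma_bounded_measurable sG bh.
apply/eqP; rewrite -subr_eq0 -meanB; [|exact: bounded_measurableM..].
apply/eqP; rewrite -[RHS](@mean_test_function G (fun x => Y x - X' x) h)//.
- by apply: eq_mean => x; rewrite mulrBl.
- exact: bounded_measurableB.
- move=> A GA.
  have mA : measurable A by exact: (proj2 sG).
  have iA (Z : M -> R) : bounded_measurable Z -> mu.-integrable A (EFin \o Z).
    by move=> bZ; apply: integrableS (bounded_measurable_integrable mu bZ).
  transitivity (\int[mu]_(x in A) (Y x - X' x)).
    by rewrite mean.unlock [RHS]Rintegral_mkcond patch_indic.
  rewrite RintegralB//; [|exact: iA bYM|exact: iA bX'].
  rewrite /Rintegral -YX// (@eq_Rintegral_ae Y Y0) ?subrr//.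
    exact: bYM.1.
  by apply: filterS aeY => x ->.
Qed.

End conditional_expectation.

(** * Reverse martingale differences and the dyadic decomposition *)

(** Indices are grouped by their residue modulo T, up to an incomplete last
    block. *)
Lemma sum_blocks {V : zmodType} (F : nat -> V) T n :
  \sum_(j < n) F j = \sum_(t < T) \sum_(m < n %/ T) F (m * T + t)%N
    + \sum_(i < n %% T) F (n %/ T * T + i)%N.
Proof.
have fold q : \sum_(j < q * T) F j = \sum_(m < q) \sum_(t < T) F (m * T + t)%N.
  elim: q => [|q IH]; first by rewrite mul0n !big_ord0.
  by rewrite big_ord_recr/= -IH mulSnr big_split_ord.
rewrite exchange_big -fold.
have cast k : k = n -> \sum_(j < n) F j = \sum_(j < k) F j by move=> ->.
by rewrite (cast _ (esym (divn_eq n T))) big_split_ord.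
Qed.

Lemma modn_le_sqrt {R : realType} (n T : nat) : (0 < T)%N ->
  (n %% T)%:R <= Num.sqrt (n%:R * T%:R) :> R.
Proof.
move=> T0.
rewrite -[leLHS]ger0_norm// -sqrtr_sqr ler_sqrt ?mulr_ge0// -natrX -natrM ler_nat expnS expn1.
by rewrite leq_mul ?leq_mod// ltnW// ltn_mod.
Qed.

Section stationary_process.
Context {R : realType} {d} {M : measurableType d}.
Variable mu : probability M R.
Variables (f : M -> M) (F0 : set (set M)).
Hypothesis mf : measurable_fun setT f.
Hypothesis pf : forall A, measurable A -> mu (f @^-1` A) = mu A.
Hypothesis sF : sub_sigma_algebra_of F0.
Hypothesis fF : forall A, F0 A -> F0 (f @^-1` A).

Local Notation E := (mean mu).
Local Notation lpnorm := (lpnorm mu).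
Local Notation adapted X := (bounded_measurable (X : g_sigma_algebraType F0 -> R)).
Implicit Types (X Z h phi : M -> R) (p : R).

Lemma measurable_iter k : measurable_fun setT (iter k f).
Proof.
elim: k => [|k IH]; first exact: measurable_id.
exact: (measurableT_comp mf IH).
Qed.

Lemma preserving_iter k (A : set M) : measurable A ->
  mu (iter k f @^-1` A) = mu A.
Proof.
elim: k A => [//|k IH] A mA.
rewrite (_ : iter k.+1 f @^-1` A = iter k f @^-1` (f @^-1` A))//.
by rewrite IH ?pf// -[_ @^-1` _]setTI; exact: mf.
Qed.

Lemma bounded_measurable_iter k X : bounded_measurable X ->
  bounded_measurable (fun x => X (iter k f x)).
Proof. exact: bounded_measurable_comp (measurable_iter k). Qed.

Lemma mean_iter k X : bounded_measurable X -> E (fun x => X (iter k f x)) = E X.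
Proof. exact: mean_comp (measurable_iter k) (@preserving_iter k). Qed.

Lemma lpnorm_iter p k X : 0 < p -> bounded_measurable X ->
  lpnorm p (fun x => X (iter k f x)) = lpnorm p X.
Proof.
by move=> p0; exact: lpnorm_comp p0 (measurable_iter k) (@preserving_iter k).
Qed.

Lemma adapted_iter k X : adapted X -> adapted (fun x => X (iter k f x)).
Proof.
have mk : @measurable_fun _ _ (g_sigma_algebraType F0) (g_sigma_algebraType F0)
    setT (iter k f).
  elim: k => [|k IH]; first exact: measurable_id.
  apply: (@measurableT_comp _ _ _ _ _ _ (f : g_sigma_algebraType F0 ->
    g_sigma_algebraType F0)) => // _ B.
  by rewrite setTI !sub_sigma_measurableE//; exact: fF.
by move=> aX; exact: (bounded_measurable_comp mk aX).
Qed.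

Lemma adapted_bounded X : adapted X -> bounded_measurable X.
Proof. exact: sub_sigma_bounded_measurable. Qed.

Definition birkhoff_sum X n x : R := \sum_(j < n) X (iter j f x).

Lemma bounded_birkhoff_sum X n : bounded_measurable X ->
  bounded_measurable (birkhoff_sum X n).
Proof.
move=> bX; apply: (@bounded_measurable_sum _ _ _ n (fun j x => X (iter j f x))).
by move=> j; exact: bounded_measurable_iter.
Qed.

Lemma lpnorm_birkhoff_sum_le p X n : 1 <= p -> bounded_measurable X ->
  lpnorm p (birkhoff_sum X n) <= n%:R * lpnorm p X.
Proof.
move=> p1 bX.
have bi j : bounded_measurable (fun x => X (iter j f x)).
  exact: bounded_measurable_iter.
apply: (le_trans (@lpnorm_sum _ _ _ _ _ n (fun j x => X (iter j f x)) p1 bi)).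
rewrite (eq_bigr (fun=> lpnorm p X)) => [|j _].
  by rewrite sumr_const card_ord mulr_natl.
by rewrite lpnorm_iter//; lra.
Qed.

Lemma birkhoff_sum_iter X n k x :
  birkhoff_sum (fun y => X (iter k f y)) n x = birkhoff_sum X n (iter k f x).
Proof. by apply: eq_bigr => j _; rewrite -!iterD addnC. Qed.

Lemma lpnorm_birkhoff_sum_iter p X n k : 0 < p -> bounded_measurable X ->
  lpnorm p (birkhoff_sum (fun y => X (iter k f y)) n) = lpnorm p (birkhoff_sum X n).
Proof.
move=> p0 bX; rewrite -(@lpnorm_iter p k (birkhoff_sum X n))//; last first.
  exact: bounded_birkhoff_sum.
by congr lpnorm; apply/funext => x; exact: birkhoff_sum_iter.
Qed.

(** Z is measurable for F0 and has zero conditional expectation given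
    f^-T F0, the latter being tested against the functions h o f^T. *)
Definition reverse_difference Z T : Prop := adapted Z /\
  forall h, adapted h -> E (fun x => Z x * h (iter T f x)) = 0.

(** The sum over m = 0, ..., N is Z plus the composition with f^T of the sum
    over one term less, which is measurable for f^-T F0; so Z is orthogonal to
    any function of it and [lpnorm_rio] applies.  Invariance of the measure
    removes the composition. *)
Lemma lpnorm_reverse_martingale p Z T N : 2 < p -> reverse_difference Z T ->
  lpnorm p (fun x => \sum_(m < N) Z (iter (m * T) f x)) ^+ 2 <=
  N%:R * (rio_constant * p * lpnorm p Z ^+ 2).
Proof.
move=> p2 [aZ Z0]; have p0 : 0 < p by lra.
have K0 := @rio_constant_gt0 R.
pose S n x := \sum_(m < n) Z (iter (m * T) f x).
have aS n : adapted (S n).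
  apply: (@bounded_measurable_sum _ _ (g_sigma_algebraType F0) n
    (fun m x => Z (iter (m * T) f x))).
  by move=> m; exact: adapted_iter.
rewrite -/(S N); elim: N => [|N IH].
  rewrite (_ : S 0 = fun=> 0); last by apply/funext => x; rewrite /S big_ord0.
  by rewrite lpnorm_cst// expr0n mul0r.
have -> : S N.+1 = fun x => S N (iter T f x) + Z x.
  apply/funext => x; rewrite /S big_ord_recl/= addrC; congr (_ + _).
  by apply: eq_bigr => m _; rewrite -iterD -mulSnr.
have bS := adapted_bounded (aS N).
apply: (le_trans (lpnorm_rio _ _ _ _)) => //.
- exact: bounded_measurable_iter.
- exact: adapted_bounded.
- rewrite -(Z0 (fun x => duality_map p (S N x))).
    by apply: eq_mean => x; rewrite mulrC.
  exact: bounded_measurable_duality_map (aS N).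
rewrite lpnorm_iter// -natr1 [leRHS]mulrDl mul1r lerD2r.
exact: IH.
Qed.

(** The summand 1 accounts for the n mod T terms of the incomplete block. *)
Definition martingale_constant p : R := Num.sqrt (rio_constant * p) + 1.

Lemma martingale_constant_ge1 p : 1 <= martingale_constant p.
Proof. by rewrite lerDr sqrtr_ge0. Qed.

(** Each of the T residue classes contributes sqrt(n / T) times the norm of Z by
    the martingale estimate, and T sqrt(n / T) = sqrt(n T). *)
Lemma lpnorm_birkhoff_reverse_difference p Z T n : 2 < p -> (0 < T)%N ->
  reverse_difference Z T ->
  lpnorm p (birkhoff_sum Z n) <=
  martingale_constant p * Num.sqrt (n%:R * T%:R) * lpnorm p Z.
Proof.
move=> p2 T0 rZ; have [aZ _] := rZ; have bZ := adapted_bounded aZ.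
have p0 : 0 < p by lra.
have p1 : 1 <= p by lra.
have K0 := @rio_constant_gt0 R.
have nZ0 := lpnorm_ge0 mu p Z.
pose q := (n %/ T)%N.
pose S x := \sum_(m < q) Z (iter (m * T) f x).
have bi j : bounded_measurable (fun x => Z (iter j f x)).
  exact: bounded_measurable_iter.
have bS : bounded_measurable S.
  exact: (@bounded_measurable_sum _ _ _ q (fun m x => Z (iter (m * T) f x))).
have -> : birkhoff_sum Z n = fun x => birkhoff_sum S T x +
    birkhoff_sum (fun y => Z (iter (q * T) f y)) (n %% T) x.
  apply/funext => x.
  rewrite /birkhoff_sum (@sum_blocks _ (fun j => Z (iter j f x)) T n).
  congr (_ + _); last by apply: eq_bigr => i _; rewrite -iterD.
  by apply: eq_bigr => t _; apply: eq_bigr => m _; rewrite -iterD.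
have bB1 := bounded_birkhoff_sum T bS.
have bB2 := bounded_birkhoff_sum (n %% T) (bi (q * T)%N).
apply: (le_trans (lpnormD _ p1 bB1 bB2)).
rewrite /martingale_constant -mulrA mulrDl mul1r; apply: lerD; last first.
  apply: (le_trans (lpnorm_birkhoff_sum_le _ p1 (bi _))).
  by rewrite lpnorm_iter// ler_wpM2r// modn_le_sqrt.
apply: (le_trans (lpnorm_birkhoff_sum_le _ p1 bS)).
have HS : lpnorm p S <= Num.sqrt (q%:R * (rio_constant * p)) * lpnorm p Z.
  rewrite -[leLHS]ger0_norm ?lpnorm_ge0// -[in leRHS](ger0_norm nZ0).
  rewrite -!sqrtr_sqr -sqrtrM; last by rewrite !mulr_ge0 ?(ltW K0) ?(ltW p0).
  rewrite ler_wsqrtr// -mulrA.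
  exact: lpnorm_reverse_martingale.
apply: (@le_trans _ _ (T%:R * (Num.sqrt (q%:R * (rio_constant * p)) * lpnorm p Z))).
  by rewrite ler_wpM2l.
rewrite mulrA [leRHS]mulrA ler_wpM2r//.
have -> : T%:R * Num.sqrt (q%:R * (rio_constant * p)) =
    Num.sqrt (T%:R ^+ 2 * (q%:R * (rio_constant * p))).
  by rewrite [in RHS]sqrtrM ?sqr_ge0// sqrtr_sqr ger0_norm.
rewrite -sqrtrM; last by rewrite mulr_ge0 ?(ltW K0) ?(ltW p0).
rewrite ler_wsqrtr//.
have -> : T%:R ^+ 2 * (q%:R * (rio_constant * p)) =
    rio_constant * p * ((q * T)%:R * T%:R) :> R by rewrite natrM; ring.
rewrite ler_wpM2l ?mulr_ge0 ?(ltW K0) ?(ltW p0)// ler_wpM2r// ler_nat.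
exact: leq_divM.
Qed.

Section dyadic_decomposition.
Variables (phi : M -> R) (past future : nat -> M -> R).
Hypothesis bphi : bounded_measurable phi.
Hypothesis apast : forall k, adapted (past k).
Hypothesis afuture : forall k, adapted (future k).
Hypothesis past_mean : forall k h, adapted h ->
  E (fun x => past k x * h x) = E (fun x => phi x * h (iter k f x)).
Hypothesis future_mean : forall k h, adapted h ->
  E (fun x => future k x * h x) = E (fun x => phi (iter k f x) * h x).

(** Here [past k] stands for E(phi o f^-k | F0) and [future k] for
    E(phi o f^k | F0).  Correlations with F0-measurable functions far in the
    future reduce to those of phi, which only depend on the total time shift. *)
Lemma past_correlation k i j h : adapted h ->
  E (fun x => past k (iter i f x) * h (iter (i + j) f x)) =
  E (fun x => phi x * h (iter (j + k) f x)).
Proof.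
move=> ah; have ahj := adapted_iter j ah.
transitivity (E (fun x => past k x * h (iter j f x))).
  rewrite -(@mean_iter i (fun x => past k x * h (iter j f x))).
    by apply: eq_mean => x; rewrite addnC iterD.
  by apply: bounded_measurableM; exact: adapted_bounded.
by rewrite past_mean//; apply: eq_mean => x; rewrite iterD.
Qed.

Lemma future_correlation k i j h : (k <= j)%N -> adapted h ->
  E (fun x => future k (iter i f x) * h (iter (i + j) f x)) =
  E (fun x => phi x * h (iter (j - k) f x)).
Proof.
move=> kj ah; have ahj := adapted_iter j ah.
have ahjk := adapted_iter (j - k) ah.
transitivity (E (fun x => future k x * h (iter j f x))).
  rewrite -(@mean_iter i (fun x => future k x * h (iter j f x))).
    by apply: eq_mean => x; rewrite addnC iterD.
  by apply: bounded_measurableM; exact: adapted_bounded.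
rewrite future_mean// -(@mean_iter k (fun x => phi x * h (iter (j - k) f x))).
  by apply: eq_mean => x; rewrite -iterD subnK.
by apply: bounded_measurableM => //; exact: adapted_bounded.
Qed.

(** E(phi | F_(-K)) - E(phi | F_K), composed with f^K to make it measurable for
    F0. *)
Definition first_difference K x := future K x - past K (iter (2 * K) f x).

Lemma reverse_difference_first K :
  reverse_difference (first_difference K) (2 * K).
Proof.
have a1 := adapted_iter (2 * K) (apast K).
split; first exact: bounded_measurableB.
move=> h ah; have bh2 := adapted_bounded (adapted_iter (2 * K) ah).
have := @future_correlation K 0 (2 * K) h (leq_pmull _ _) ah => /(_ isT) HV.
have HA := @past_correlation K (2 * K) 0 h ah.
rewrite (_ : 2 * K - K = K)%N in HV; last by lia.
rewrite addn0 in HA.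
transitivity (E (fun x => future K x * h (iter (2 * K) f x) -
    past K (iter (2 * K) f x) * h (iter (2 * K) f x))).
  by apply: eq_mean => x; rewrite mulrBl.
rewrite meanB ?HV ?HA ?subrr//; apply: bounded_measurableM => //;
  exact: adapted_bounded.
Qed.

(** The piece w_K, composed with f^(2K) to make it measurable for F0. *)
Definition scale_difference K x :=
  (future (2 * K) x - future K (iter K f x)) +
  (past K (iter (3 * K) f x) - past (2 * K) (iter (4 * K) f x)).

(** Tested against h o f^(4K), each of the four terms gives the mean of
    phi * h o f^(2K), and the signs cancel. *)
Lemma reverse_difference_scale K :
  reverse_difference (scale_difference K) (4 * K).
Proof.
have v1 := adapted_iter K (afuture K).
have a1 := adapted_iter (3 * K) (apast K).
have a2 := adapted_iter (4 * K) (apast (2 * K)).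
split; first by apply: bounded_measurableD; exact: bounded_measurableB.
move=> h ah; have bh := adapted_bounded (adapted_iter (4 * K) ah).
have V2 : (2 * K <= 4 * K)%N by lia.
have V1 : (K <= 3 * K)%N by lia.
have HV2 := @future_correlation (2 * K) 0 (4 * K) h V2 ah.
have HV1 := @future_correlation K K (3 * K) h V1 ah.
have HA1 := @past_correlation K (3 * K) K h ah.
have HA2 := @past_correlation (2 * K) (4 * K) 0 h ah.
rewrite (_ : 4 * K - 2 * K = 2 * K)%N in HV2; last by lia.
rewrite (_ : 3 * K - K = 2 * K)%N in HV1; last by lia.
rewrite (_ : K + 3 * K = 4 * K)%N in HV1; last by lia.
rewrite (_ : 3 * K + K = 4 * K)%N in HA1; last by lia.
rewrite (_ : K + K = 2 * K)%N in HA1; last by lia.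
rewrite addn0 add0n in HA2.
have bh' X : adapted X -> bounded_measurable (fun x => X x * h (iter (4 * K) f x)).
  by move=> aX; apply: bounded_measurableM => //; exact: adapted_bounded.
transitivity (E (fun x => (future (2 * K) x * h (iter (4 * K) f x) -
      future K (iter K f x) * h (iter (4 * K) f x)) +
    (past K (iter (3 * K) f x) * h (iter (4 * K) f x) -
     past (2 * K) (iter (4 * K) f x) * h (iter (4 * K) f x)))).
  by apply: eq_mean => x; rewrite /scale_difference; ring.
rewrite meanD; [|by apply: bounded_measurableB; exact: bh'..].
rewrite !meanB; [|exact: bh'..].
by rewrite HV2 HV1 HA1 HA2; ring.
Qed.

Definition scale_error p K : R := lpnorm p (past K) +
  lpnorm p (fun x => future K x - phi (iter K f x)).

(** phi - E(phi | F_(-K)) + E(phi | F_K), composed with f^K: what is left of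
    phi after the pieces up to scale K have been removed. *)
Definition scale_remainder K x :=
  phi (iter K f x) - future K x + past K (iter (2 * K) f x).

Let bpast k i : bounded_measurable (fun x => past k (iter i f x)).
Proof. by apply: bounded_measurable_iter; exact: adapted_bounded. Qed.

Let bfuture k : bounded_measurable (future k).
Proof. exact: adapted_bounded. Qed.

Let bphii k : bounded_measurable (fun x => phi (iter k f x)).
Proof. exact: bounded_measurable_iter. Qed.

Let bdiff k : bounded_measurable (fun x => future k x - phi (iter k f x)).
Proof. exact: bounded_measurableB. Qed.

Lemma bounded_scale_remainder K : bounded_measurable (scale_remainder K).
Proof. by apply: bounded_measurableD => //; exact: bounded_measurableB. Qed.

Lemma lpnorm_scale_remainder p K : 1 <= p ->
  lpnorm p (scale_remainder K) <= scale_error p K.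
Proof.
move=> p1.
apply: (le_trans (lpnormD _ p1 _ _)) => //; first exact: bounded_measurableB.
rewrite lpnorm_iter//; [|by lra|exact: adapted_bounded].
rewrite addrC lerD2l -lpnormN.
by under [X in lpnorm p X]eq_fun do rewrite opprB.
Qed.

Lemma lpnorm_first_difference p K : 1 <= p ->
  lpnorm p (first_difference K) <= lpnorm p phi + scale_error p K.
Proof.
move=> p1; have p0 : 0 < p by lra.
have -> : first_difference K = fun x => (future K x - phi (iter K f x)) +
    (phi (iter K f x) - past K (iter (2 * K) f x)).
  by apply/funext => x; rewrite /first_difference; ring.
apply: (le_trans (lpnormD _ p1 _ _)) => //; first exact: bounded_measurableB.
have := lpnormB mu p1 (bphii K) (bpast K (2 * K)).
rewrite !lpnorm_iter//; last exact: adapted_bounded.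
rewrite /scale_error; lra.
Qed.

Lemma lpnorm_scale_difference p K : 1 <= p ->
  lpnorm p (scale_difference K) <= scale_error p K + scale_error p (2 * K).
Proof.
move=> p1; have p0 : 0 < p by lra.
have bd := bounded_measurable_iter K (bdiff K).
have -> : scale_difference K = fun x =>
    ((future (2 * K) x - phi (iter (2 * K) f x)) -
     (future K (iter K f x) - phi (iter K f (iter K f x)))) +
    (past K (iter (3 * K) f x) - past (2 * K) (iter (4 * K) f x)).
  apply/funext => x; rewrite /scale_difference -iterD addnn -mul2n; ring.
apply: (le_trans (lpnormD _ p1 _ _)); [exact: bounded_measurableB..|].
have := lpnormB mu p1 (bpast K (3 * K)) (bpast (2 * K) (4 * K)).
have := lpnormB mu p1 (bdiff (2 * K)) bd.
rewrite (@lpnorm_iter p K (fun x => future K x - phi (iter K f x)))//.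
rewrite !(@lpnorm_iter p _ (past _))//; [|exact: adapted_bounded..].
rewrite /scale_error; lra.
Qed.

(** The remainder at scale K, composed with f^K, is the remainder at scale 2K
    plus the piece of scale K.  Invariance of the measure makes these
    compositions harmless for the norms, so the scales can be peeled off one by
    one; the last remainder is bounded by the triangle inequality. *)
Lemma lpnorm_birkhoff_sum_dyadic p K n r : 2 < p -> (0 < K)%N ->
  lpnorm p (birkhoff_sum phi n) <=
  martingale_constant p *
    (Num.sqrt (n%:R * (2 * K)%:R) * (lpnorm p phi + scale_error p K) +
     \sum_(i < r) Num.sqrt (n%:R * (4 * (K * 2 ^ i))%:R) *
       (scale_error p (K * 2 ^ i) + scale_error p (K * 2 ^ i.+1)))
  + n%:R * scale_error p (K * 2 ^ r).
Proof.
move=> p2 K0; have p1 : 1 <= p by lra.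
have p0 : 0 < p by lra.
have C0 : 0 <= martingale_constant p.
  by apply: le_trans (martingale_constant_ge1 p).
have addS X Y : bounded_measurable X -> bounded_measurable Y ->
    lpnorm p (birkhoff_sum (fun x => X x + Y x) n) <=
    lpnorm p (birkhoff_sum X n) + lpnorm p (birkhoff_sum Y n).
  move=> bX bY; rewrite (_ : birkhoff_sum _ n =
      fun x => birkhoff_sum X n x + birkhoff_sum Y n x); last first.
    by apply/funext => x; rewrite /birkhoff_sum big_split.
  by apply: lpnormD => //; exact: bounded_birkhoff_sum.
have bfirst : bounded_measurable (first_difference K).
  exact: bounded_measurableB.
have bscale L : bounded_measurable (scale_difference L).
  apply: bounded_measurableD; apply: bounded_measurableB => //.
  by apply: bounded_measurable_iter.
have start : lpnorm p (birkhoff_sum phi n) <=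
    lpnorm p (birkhoff_sum (scale_remainder K) n) +
    martingale_constant p * (Num.sqrt (n%:R * (2 * K)%:R) *
      (lpnorm p phi + scale_error p K)).
  rewrite -(@lpnorm_birkhoff_sum_iter p phi n K)//.
  rewrite (_ : (fun y => _) =
      fun x => scale_remainder K x + first_difference K x); last first.
    by apply/funext => x; rewrite /scale_remainder /first_difference; ring.
  apply: (le_trans (addS _ _ (bounded_scale_remainder K) bfirst)).
  rewrite lerD2l mulrA.
  apply: (le_trans (lpnorm_birkhoff_reverse_difference _ p2 _
    (reverse_difference_first K))); first by rewrite muln_gt0.
  by rewrite ler_wpM2l ?mulr_ge0 ?sqrtr_ge0// lpnorm_first_difference.
have step L : (0 < L)%N -> lpnorm p (birkhoff_sum (scale_remainder L) n) <=
    lpnorm p (birkhoff_sum (scale_remainder (2 * L)) n) +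
    martingale_constant p * (Num.sqrt (n%:R * (4 * L)%:R) *
      (scale_error p L + scale_error p (2 * L))).
  move=> L0; rewrite -(@lpnorm_birkhoff_sum_iter p (scale_remainder L) n L)//; last first.
    exact: bounded_scale_remainder.
  rewrite (_ : (fun y => _) =
      fun x => scale_remainder (2 * L) x + scale_difference L x); last first.
    apply/funext => x; rewrite /scale_remainder /scale_difference -!iterD.
    rewrite (_ : L + L = 2 * L)%N; last by lia.
    rewrite (_ : 2 * L + L = 3 * L)%N; last by lia.
    by rewrite (_ : 2 * (2 * L) = 4 * L)%N; [ring|lia].
  apply: (le_trans (addS _ _ (bounded_scale_remainder _) (bscale L))).
  rewrite lerD2l mulrA.
  apply: (le_trans (lpnorm_birkhoff_reverse_difference _ p2 _
    (reverse_difference_scale L))); first by rewrite muln_gt0.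
  by rewrite ler_wpM2l ?mulr_ge0 ?sqrtr_ge0// lpnorm_scale_difference.
apply: (@le_trans _ _ (martingale_constant p *
    (Num.sqrt (n%:R * (2 * K)%:R) * (lpnorm p phi + scale_error p K) +
     \sum_(i < r) Num.sqrt (n%:R * (4 * (K * 2 ^ i))%:R) *
       (scale_error p (K * 2 ^ i) + scale_error p (K * 2 ^ i.+1)))
  + lpnorm p (birkhoff_sum (scale_remainder (K * 2 ^ r)) n))); last first.
  rewrite lerD2l.
  apply: (le_trans (lpnorm_birkhoff_sum_le n p1 (bounded_scale_remainder _))).
  by rewrite ler_wpM2l// lpnorm_scale_remainder.
elim: r => [|r IH].
  by rewrite big_ord0 addr0 expn0 muln1 addrC.
apply: (le_trans IH); rewrite big_ord_recr/=.
have Kr : (0 < K * 2 ^ r)%N by rewrite muln_gt0 K0 expn_gt0.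
have := step _ Kr.
rewrite (_ : 2 * (K * 2 ^ r) = K * 2 ^ r.+1)%N; last by rewrite expnS; lia.
set a := _ + \sum_(i < r) _; set b := Num.sqrt _ * _.
rewrite [in X in _ -> X]addrA !mulrDr; lra.
Qed.

(** The piece of scale K 2^i contributes a multiple of
    sqrt(n K) sqrt(2^i) theta^i.  Once K 2^(r+1) >= n, the last remainder is
    of the same form with i = r, since n <= sqrt(n) sqrt(K 2^(r+1)).  In the
    constant 7, the scales contribute 4 and the first difference 3, the latter
    because the sum is at least 1. *)
Lemma lpnorm_birkhoff_sum_geometric p K n r (B theta : R) : 2 < p -> (0 < K)%N ->
  0 < theta <= 1 -> lpnorm p phi <= B ->
  (forall i, scale_error p (K * 2 ^ i) <= B * theta ^+ i) ->
  (n <= K * 2 ^ r.+1)%N ->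
  lpnorm p (birkhoff_sum phi n) <=
  7 * martingale_constant p * B * Num.sqrt (n%:R * K%:R) *
    \sum_(i < r.+1) (Num.sqrt 2 * theta) ^+ i.
Proof.
move=> p2 K0 /andP[t0 t1] phiB errB nK.
have B0 : 0 <= B by apply: le_trans phiB; exact: lpnorm_ge0.
pose Q : R := Num.sqrt (n%:R * K%:R); have Q0 : 0 <= Q by exact: sqrtr_ge0.
pose lambda := Num.sqrt 2 * theta.
have l0 : 0 <= lambda by rewrite mulr_ge0 ?sqrtr_ge0 ?ltW.
pose mc := martingale_constant p.
have mc1 : 1 <= mc by exact: martingale_constant_ge1.
pose G := \sum_(i < r) lambda ^+ i.
have G0 : 0 <= G by apply: sumr_ge0 => i _; exact: exprn_ge0.
have lr0 : 0 <= lambda ^+ r by exact: exprn_ge0.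
have G1 : 1 <= G + lambda ^+ r.
  rewrite /G; case: (r) => [|m]; first by rewrite big_ord0 expr0 add0r.
  rewrite big_ord_recl expr0 -addrA lerDl addr_ge0 ?exprn_ge0//.
  by apply: sumr_ge0 => i _; exact: exprn_ge0.
have sqrt_mul (a : R) : 0 <= a -> Num.sqrt (a * (n%:R * K%:R)) = Num.sqrt a * Q.
  by move=> a0; rewrite sqrtrM.
have s2 := @sqrt2_le R.
have s20 : 0 <= Num.sqrt 2 :> R by exact: sqrtr_ge0.
have s4 : Num.sqrt 4 = 2 :> R.
  by rewrite (_ : 4 = 2 ^+ 2 :> R) ?sqrtr_sqr ?ger0_norm//; rewrite expr2; ring.
have H1 : Num.sqrt (n%:R * (2 * K)%:R) * (lpnorm p phi + scale_error p K)
    <= 3 * (Q * B).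
  rewrite natrM mulrCA sqrt_mul//.
  have := errB 0%N; rewrite expn0 muln1 expr0 mulr1 => e0.
  apply: (@le_trans _ _ (Num.sqrt 2 * Q * (2 * B))).
    by rewrite ler_wpM2l ?mulr_ge0//; lra.
  have QB0 : 0 <= Q * B by rewrite mulr_ge0.
  have -> : Num.sqrt 2 * Q * (2 * B) = Num.sqrt 2 * 2 * (Q * B) by ring.
  by rewrite ler_wpM2r//; lra.
have H2 : \sum_(i < r) Num.sqrt (n%:R * (4 * (K * 2 ^ i))%:R) *
    (scale_error p (K * 2 ^ i) + scale_error p (K * 2 ^ i.+1)) <=
    4 * (Q * B) * G.
  rewrite /G mulr_sumr; apply: ler_sum => i _.
  have -> : n%:R * (4 * (K * 2 ^ i))%:R = 4 * (2 ^+ i * (n%:R * K%:R)) :> R.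
    by rewrite !natrM natrX; ring.
  rewrite sqrtrM// s4 sqrt_mul ?exprn_ge0// sqrt_pow2.
  have e1 := errB i; have e2 := errB i.+1.
  have ti : 0 <= theta ^+ i by rewrite exprn_ge0 ?ltW.
  have e3 : B * theta ^+ i.+1 <= B * theta ^+ i.
    by rewrite exprS ler_wpM2l// ler_piMl.
  apply: (@le_trans _ _ (2 * (Num.sqrt 2 ^+ i * Q) * (2 * (B * theta ^+ i)))).
    by rewrite ler_wpM2l ?mulr_ge0 ?exprn_ge0//; lra.
  by rewrite /lambda exprMn le_eqVlt; apply/orP; left; apply/eqP; ring.
have H3 : n%:R * scale_error p (K * 2 ^ r) <= 2 * (Q * B) * lambda ^+ r.
  have nQ : n%:R <= Num.sqrt 2 * Num.sqrt 2 ^+ r * Q.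
    have -> : Num.sqrt 2 * Num.sqrt 2 ^+ r * Q =
        Num.sqrt (n%:R * (K * 2 ^ r.+1)%:R).
      rewrite -exprS natrM mulrA natrX [_ * 2 ^+ _]mulrC sqrt_mul ?exprn_ge0//.
      by rewrite sqrt_pow2.
    rewrite -[leLHS]ger0_norm// -sqrtr_sqr expr2 ler_wsqrtr// ler_wpM2l//.
    by rewrite ler_nat.
  apply: (@le_trans _ _ (Num.sqrt 2 * Num.sqrt 2 ^+ r * Q * (B * theta ^+ r))).
    by apply: ler_pM => //; rewrite /scale_error addr_ge0 ?lpnorm_ge0.
  have -> : Num.sqrt 2 * Num.sqrt 2 ^+ r * Q * (B * theta ^+ r) =
    Num.sqrt 2 * (Q * B * lambda ^+ r) by rewrite /lambda exprMn; ring.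
  have z0 : 0 <= Q * B * lambda ^+ r by rewrite !mulr_ge0.
  by rewrite -[leRHS]mulrA; nra.
have := @lpnorm_birkhoff_sum_dyadic p K n r p2 K0.
rewrite -/mc big_ord_recr/= -/lambda -/G -/Q.
have QB0 : 0 <= Q * B by rewrite mulr_ge0.
move=> /le_trans; apply.
apply: (@le_trans _ _ (mc * (3 * (Q * B) + 4 * (Q * B) * G) +
    mc * (2 * (Q * B) * lambda ^+ r))).
  apply: lerD.
    by rewrite ler_wpM2l ?lerD//; lra.
  apply: (le_trans H3); rewrite ler_peMl//.
  by rewrite !mulr_ge0.
rewrite -mulrDr.
have -> : 7 * mc * B * Q * (G + lambda ^+ r) = mc * (7 * (Q * B) * (G + lambda ^+ r)).
  by ring.
rewrite ler_wpM2l//; first by lra.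
move: QB0 G1 lr0 G0; set w := Q * B; set g := G; set l := _ ^+ r.
move=> w0 g1 l0' g0.
have : 0 <= w * (g + l - 1) by rewrite mulr_ge0//; lra.
have : 0 <= w * g by exact: mulr_ge0.
have : 0 <= w * l by exact: mulr_ge0.
lra.
Qed.

End dyadic_decomposition.
End stationary_process.

(** * From growth of moments to stretched exponential deviations *)

Section deviations_from_moments.
Context {R : realType}.
Implicit Types (a s t u x omega tau : R).

(** Raise x / s <= exp(x / s) to the power s. *)
Lemma powR_le_expR s x : 0 < s -> 0 <= x -> x `^ s <= s `^ s * expR x.
Proof.
move=> s0 x0.
have -> : expR x = expR (x / s) `^ s by rewrite -expRM divfK ?gt_eqF.
rewrite -powRM ?expR_ge0 ?(ltW s0)//.
rewrite ge0_ler_powR ?nnegrE ?(ltW s0) ?mulr_ge0 ?expR_ge0 ?(ltW s0)//.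
rewrite -ler_pdivrMl// mulrC.
by have := expR_ge1Dx (x / s); lra.
Qed.

(** A stretched exponential decays at least like 1 / u, which is all that is
    needed to sum over dyadic scales. *)
Lemma stretched_exp_decay omega tau u : 0 < omega -> 0 < tau -> 0 < u ->
  expR (- (tau * u `^ omega)) <= (omega * tau)^-1 `^ omega^-1 * u^-1.
Proof.
move=> o0 t0 u0.
have x0 : 0 <= tau * u `^ omega by rewrite mulr_ge0 ?powR_ge0 ?ltW.
have oi0 : 0 < omega^-1 by rewrite invr_gt0.
have := powR_le_expR oi0 x0.
rewrite powRM ?powR_ge0 ?(ltW t0)// -powRrM mulfV ?gt_eqF// powRr1 ?(ltW u0)// => H.
rewrite expRN ler_pdivlMr// mulrC ler_pdivrMr ?expR_gt0//.
rewrite invfM powRM ?invr_ge0 ?(ltW o0) ?(ltW t0)//.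
have tp : 0 < tau `^ omega^-1 by exact: powR_gt0.
rewrite -(ler_pM2l tp); apply: (le_trans H).
rewrite [tau^-1 `^ _](_ : _ = (tau `^ omega^-1)^-1); last first.
  by rewrite -powR_inv1 ?(ltW t0)// -powRrM mulN1r powRN.
rewrite le_eqVlt; apply/orP; left; apply/eqP; field.
by rewrite gt_eqF.
Qed.

Lemma geometric_sum_le (lambda : R) m : 0 <= lambda -> lambda < 1 ->
  \sum_(i < m) lambda ^+ i <= (1 - lambda)^-1.
Proof.
move=> l0 l1; have d0 : 0 < 1 - lambda by lra.
rewrite -[leRHS]mul1r ler_pdivlMr// mulrC.
have -> : (1 - lambda) * \sum_(i < m) lambda ^+ i = 1 - lambda ^+ m.
  by have := subrX1 lambda m; rewrite -[1 - lambda]opprB mulNr => <-; rewrite opprB.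
by have := exprn_ge0 m l0; lra.
Qed.

Lemma geometric_sum_le_last (lambda : R) m : 1 < lambda ->
  \sum_(i < m) lambda ^+ i <= lambda ^+ m / (lambda - 1).
Proof.
move=> l1; have d0 : 0 < lambda - 1 by lra.
rewrite ler_pdivlMr// mulrC -subrX1; lra.
Qed.

Context {d} {T : measurableType d}.
Variable mu : probability T R.

(** Put t = sqrt n * eps / (c e).  For large t, Markov's inequality with
    exponent K ^ omega, where K is the integer part of t, has base at most 1 / e.
    For bounded t, a small tau makes the right-hand side at least 1. *)
Lemma deviation_of_moments (S : nat -> T -> R) omega (c : R) :
  0 < omega <= 1 -> 0 < c -> (forall n, bounded_measurable (S n)) ->
  (forall K n, (0 < K)%N -> 2 < K%:R `^ omega ->
    lpnorm mu (K%:R `^ omega) (S n) <= c * K%:R * Num.sqrt n%:R) ->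
  exists2 tau : R, 0 < tau & forall n (eps : R), (1 <= n)%N -> 0 < eps ->
    (mu [set x | (n%:R * eps < `|S n x|)%R]
      <= (2 * expR (- (tau * n%:R `^ (omega / 2) * eps `^ omega)))%:E)%E.
Proof.
move=> /andP[ o0 o1] c0 bS HS.
pose e : R := expR 1.
have e0 : 0 < e by exact: expR_gt0.
(* From t >= L on, the integer part K of t satisfies K ^ omega >= 3 > 2. *)
pose L : R := 3 `^ omega^-1 + 1.
have L1 : 1 <= L by rewrite lerDr powR_ge0.
pose tau1 := (2 * (c * e))^-1 `^ omega.
pose tau2 := (2 * (c * e * L) `^ omega)^-1.
have t10 : 0 < tau1 by rewrite powR_gt0// invr_gt0 !mulr_gt0.
have L0 : 0 < L by lra.
have t20 : 0 < tau2 by rewrite invr_gt0 mulr_gt0// powR_gt0// !mulr_gt0.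
exists (Num.min tau1 tau2); first by rewrite lt_min t10.
move=> n eps n1 eps0.
have n0 : 0 < n%:R :> R by rewrite ltr0n.
pose w := Num.sqrt n%:R * eps.
have sn0 : 0 < Num.sqrt n%:R :> R by rewrite sqrtr_gt0.
have w0 : 0 < w by rewrite mulr_gt0.
have wE : n%:R `^ (omega / 2) * eps `^ omega = w `^ omega.
  rewrite /w powRM ?sqrtr_ge0 ?(ltW eps0)// -powR12_sqrt// -powRrM.
  by congr (_ `^ _ * _); field.
rewrite -mulrA wE.
set A := [set x | _].
have mA : measurable A.
  rewrite -[A]setTI; apply: measurable_fun_ltr => //.
  by have [] := bounded_measurable_norm (bS n).
pose t := w / (c * e).
have ce0 : 0 < c * e by rewrite mulr_gt0.
have wt : w = c * e * t by rewrite /t mulrC divfK ?gt_eqF.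
have t0 : 0 < t by rewrite divr_gt0.
have [tL|Lt] := ltP t L.
  apply: (@le_trans _ _ 1%E); first exact: probability_le1.
  rewrite lee_fin.
  have x2 : Num.min tau1 tau2 * w `^ omega <= 2^-1.
    apply: (@le_trans _ _ (tau2 * (c * e * L) `^ omega)).
      apply: ler_pM; rewrite ?powR_ge0//.
      - by rewrite le_min (ltW t10) (ltW t20).
      - by rewrite ge_min lexx orbT.
      - have ceL : c * e * t <= c * e * L by rewrite ler_pM2l// ltW.
        rewrite wt ge0_ler_powR ?nnegrE ?(ltW o0)//; last first.
          by rewrite mulr_ge0 ?ltW.
        by rewrite mulr_ge0 ?ltW.
    have : 0 < (c * e * L) `^ omega by rewrite powR_gt0// !mulr_gt0.
    rewrite /tau2; set z := _ `^ omega => z0.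
    by rewrite le_eqVlt; apply/orP; left; apply/eqP; field; rewrite gt_eqF.
  have := expR_ge1Dx (- (Num.min tau1 tau2 * w `^ omega)).
  by lra.
pose K := Num.truncn t.
have t1 : 1 <= t by exact: le_trans L1 Lt.
have Kt : K%:R <= t by rewrite truncn_le ?ltW.
have tK : t < K%:R + 1 by rewrite natr1; exact: truncnS_gt.
have K0 : (0 < K)%N by rewrite -(ltr_nat R); rewrite -(ltrD2r 1) add0r; lra.
have K1 : 1 <= K%:R :> R by rewrite ler1n.
have p2 : 2 < K%:R `^ omega.
  apply: (@lt_le_trans _ _ 3); first by lra.
  have -> : 3 = (3 `^ omega^-1) `^ omega :> R.
    by rewrite -powRrM mulVf ?gt_eqF// powRr1.
  by rewrite ge0_ler_powR ?nnegrE ?powR_ge0 ?(ltW o0)//; rewrite /L in Lt; lra.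
have p0 : 0 < K%:R `^ omega by lra.
have ne0 : 0 < n%:R * eps by rewrite mulr_gt0.
apply: (le_trans (lpnorm_markov mu p0 ne0 (bS n))).
rewrite lee_fin.
have H1 : lpnorm mu (K%:R `^ omega) (S n) / (n%:R * eps) <= expR (-1).
  apply: (@le_trans _ _ (c * K%:R * Num.sqrt n%:R / (n%:R * eps))).
    by rewrite ler_wpM2r ?invr_ge0 ?(ltW ne0)// HS.
  have nn : n%:R = Num.sqrt n%:R * Num.sqrt n%:R :> R.
    by rewrite -expr2 sqr_sqrtr.
  have -> : c * K%:R * Num.sqrt n%:R / (n%:R * eps) = c * K%:R / w.
    rewrite /w {2}nn; field.
    by rewrite !gt_eqF.
  rewrite wt expRN -/e ler_pdivrMr ?(mulr_gt0 ce0 t0)//.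
  have -> : e^-1 * (c * e * t) = c * t by field; rewrite gt_eqF.
  by rewrite ler_pM2l.
apply: (@le_trans _ _ (expR (-1) `^ (K%:R `^ omega))).
  apply: ge0_ler_powR H1; rewrite ?nnegrE ?expR_ge0 ?(ltW p0)//.
  by rewrite divr_ge0 ?lpnorm_ge0 ?(ltW ne0).
rewrite -expRM mulN1r.
apply: (@le_trans _ _ (expR (- (Num.min tau1 tau2 * w `^ omega)))); last first.
  by have := expR_gt0 (- (Num.min tau1 tau2 * w `^ omega)); lra.
rewrite ler_expR lerN2.
apply: (@le_trans _ _ (tau1 * w `^ omega)).
  by rewrite ler_wpM2r ?powR_ge0// ge_min lexx.
have a0 : 0 <= (2 * (c * e))^-1 by rewrite invr_ge0 ltW// mulr_gt0.
rewrite /tau1 -powRM ?(ltW w0)//.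
have -> : (2 * (c * e))^-1 * w = t / 2.
  by rewrite wt; field; rewrite !gt_eqF.
rewrite ge0_ler_powR ?nnegrE ?(ltW o0)//; first by rewrite ltW// divr_gt0.
lra.
Qed.

End deviations_from_moments.

(** * Maximal functions over dyadic blocks *)

Section maximal_function.
Context {R : realType} {d} {M : measurableType d}.
Variable mu : probability M R.
Variable f : M -> M.
Hypothesis mf : measurable_fun setT f.
Hypothesis pf : forall A, measurable A -> mu (f @^-1` A) = mu A.
Variable phi : M -> R.
Hypothesis bphi : bounded_measurable phi.

Local Notation lpnorm := (lpnorm mu).
Local Notation S := (birkhoff_sum f phi).

(** A majorant of the maximum of |S_k| over k <= 2^r that can be estimated by
    recursion: for k > 2^(r-1), the first 2^(r-1) terms are split off. *)
Fixpoint dyadic_maximal r : M -> R :=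
  if r is r'.+1 then
    fun x => Num.max (dyadic_maximal r' x)
      (`|S (2 ^ r') x| + dyadic_maximal r' (iter (2 ^ r') f x))
  else fun x => `|phi x|.

Lemma bounded_dyadic_maximal r : bounded_measurable (dyadic_maximal r).
Proof.
elim: r => [|r IH] /=; first exact: bounded_measurable_norm.
apply: bounded_measurable_max => //; apply: bounded_measurableD.
  exact/bounded_measurable_norm/bounded_birkhoff_sum.
exact: bounded_measurable_iter.
Qed.

Lemma dyadic_maximal_ge0 r x : 0 <= dyadic_maximal r x.
Proof. by elim: r => [|r IH] //=; rewrite le_max IH. Qed.

Lemma birkhoff_sum_le_dyadic_maximal r k x : (k <= 2 ^ r)%N ->
  `|S k x| <= dyadic_maximal r x.
Proof.
elim: r k x => [|r IH] k x kr.
  case: k kr => [|[|//]] _; rewrite /birkhoff_sum.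
    by rewrite big_ord0 normr0 dyadic_maximal_ge0.
  by rewrite big_ord1.
rewrite /= le_max; have [k2|k2] := leqP k (2 ^ r); first by rewrite IH.
apply/orP; right.
have cast j : j = k -> S k x = S j x by move=> ->.
rewrite (cast _ (subnKC (ltnW k2))).
have -> : S (2 ^ r + (k - 2 ^ r)) x =
    S (2 ^ r) x + S (k - 2 ^ r) (iter (2 ^ r) f x).
  rewrite /birkhoff_sum big_split_ord/=; congr (_ + _).
  by apply: eq_bigr => i _; rewrite addnC iterD.
apply: (le_trans (ler_normD _ _)); rewrite lerD2l IH//.
by move: kr; rewrite expnS; lia.
Qed.

Lemma lpnorm_max p (X Y : M -> R) : 0 < p -> bounded_measurable X ->
  bounded_measurable Y -> (forall x, 0 <= X x) -> (forall x, 0 <= Y x) ->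
  lpnorm p (fun x => Num.max (X x) (Y x)) `^ p <= lpnorm p X `^ p + lpnorm p Y `^ p.
Proof.
move=> p0 bX bY X0 Y0.
have bp Z : bounded_measurable Z -> bounded_measurable (fun x : M => `|Z x| `^ p).
  by apply: bounded_measurable_powR; exact: ltW.
rewrite !powR_lpnorm// -meanD; [|exact: bp..].
apply: le_mean.
- exact/bp/bounded_measurable_max.
- by apply: bounded_measurableD; exact: bp.
- move=> x; case: (lerP (X x) (Y x)) => _.
    by rewrite lerDr powR_ge0.
  by rewrite lerDl powR_ge0.
Qed.

(** If the norm at level r is at most D sigma^r, then the p-th power of the norm
    at level r + 1 is at most (D^p + (C + D)^p) sigma^(r p).  As sigma^p > 2,
    this is at most (D sigma^(r+1))^p as soon as
    C + D <= (sigma^p - 1)^(1/p) D, which holds for large D. *)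
Lemma lpnorm_dyadic_maximal p (C sigma : R) : 1 <= p -> 0 < sigma ->
  2 < sigma `^ p -> (forall r, lpnorm p (S (2 ^ r)) <= C * sigma ^+ r) ->
  exists2 D, 0 < D & forall r, lpnorm p (dyadic_maximal r) <= D * sigma ^+ r.
Proof.
move=> p1 s0 sp HS; have p0 : 0 < p by lra.
(* Chosen so that 1 + rho ^ p = sigma ^ p. *)
pose rho := (sigma `^ p - 1) `^ p^-1.
have rhop : rho `^ p = sigma `^ p - 1.
  by rewrite -powRrM mulVf ?gt_eqF// powRr1//; lra.
have rho1 : 1 < rho.
  rewrite ltNge; apply/negP => r1.
  have : rho `^ p <= 1 `^ p by rewrite ge0_ler_powR ?nnegrE ?powR_ge0// ltW.
  by rewrite rhop powR1; lra.
have rm0 : 0 < rho - 1 by lra.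
pose D := Num.max 1 (Num.max (lpnorm p phi) (C / (rho - 1))).
have D1 : 1 <= D by rewrite le_max lexx.
have D0 : 0 < D by lra.
have Dphi : lpnorm p phi <= D by rewrite /D !le_max lexx orbT.
have DC : C <= (rho - 1) * D.
  by rewrite mulrC -ler_pdivrMr// /D !le_max lexx !orbT.
exists D => //.
elim=> [|r IH]; first by rewrite expr0 mulr1 /= lpnorm_norm.
have sr0 : 0 <= sigma ^+ r by rewrite exprn_ge0// ltW.
have bQ := bounded_dyadic_maximal r.
have bQi := bounded_measurable_iter mf (2 ^ r) bQ.
have bS := bounded_measurable_norm (bounded_birkhoff_sum mf (2 ^ r) bphi).
have HY : lpnorm p (fun x => `|S (2 ^ r) x| + dyadic_maximal r (iter (2 ^ r) f x))
    <= rho * D * sigma ^+ r.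
  apply: (le_trans (lpnormD mu p1 bS bQi)).
  rewrite lpnorm_norm (lpnorm_iter mf pf)//.
  have := HS r; have : 0 <= ((rho - 1) * D - C) * sigma ^+ r.
    by rewrite mulr_ge0//; lra.
  lra.
have sr1 : 0 <= D * sigma ^+ r.+1 by rewrite mulr_ge0 ?exprn_ge0 ?ltW.
rewrite leNgt; apply/negP => lt1.
have : (D * sigma ^+ r.+1) `^ p < lpnorm p (dyadic_maximal r.+1) `^ p.
  by rewrite gt0_ltr_powR ?nnegrE ?lpnorm_ge0.
apply/negP; rewrite -leNgt.
have Q0 x : 0 <= dyadic_maximal r x by exact: dyadic_maximal_ge0.
apply: (le_trans (lpnorm_max p0 bQ (bounded_measurableD bS bQi) Q0 _)).
  by move=> x; rewrite addr_ge0.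
apply: (@le_trans _ _ ((D * sigma ^+ r) `^ p + (rho * D * sigma ^+ r) `^ p)).
  have rD : 0 <= rho * D * sigma ^+ r by rewrite !mulr_ge0//; lra.
  have rD' : 0 <= D * sigma ^+ r by rewrite !mulr_ge0//; lra.
  by apply: lerD; rewrite ge0_ler_powR ?nnegrE ?lpnorm_ge0// ltW.
have Dr0 : 0 <= D * sigma ^+ r by rewrite mulr_ge0// ltW.
have -> : rho * D * sigma ^+ r = rho * (D * sigma ^+ r) by ring.
have -> : D * sigma ^+ r.+1 = sigma * (D * sigma ^+ r) by rewrite exprS; ring.
have rho0 : 0 <= rho by lra.
rewrite !(@powRM _ _ (D * sigma ^+ r))// ?(ltW s0)// rhop.
by rewrite le_eqVlt; apply/orP; left; apply/eqP; ring.
Qed.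

(** For k in [2^t, 2^(t+1)), a deviation at time k forces the maximal function
    of level t + 1 to exceed 2^t eps.  By Markov's inequality this has
    probability at most (D sigma / eps)^p q^t, and these are summed over
    t >= s. *)
Lemma maximal_deviation p (C sigma q : R) : 1 <= p -> 0 < sigma ->
  2 < sigma `^ p -> 0 < q < 1 -> (sigma / 2) `^ p = q ->
  (forall r, lpnorm p (S (2 ^ r)) <= C * sigma ^+ r) ->
  exists2 K, 0 < K & forall s (eps : R), 0 < eps ->
    exists2 B : set M, measurable B &
      (forall x k, (2 ^ s <= k)%N -> k%:R * eps < `|S k x| -> B x) /\
      (mu B <= (K * eps `^ (- p) * q ^+ s)%:E)%E.
Proof.
move=> p1 s0 sp /andP[q0 q1] sq HS.
have [D D0 HD] := lpnorm_dyadic_maximal p1 s0 sp HS.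
have p0 : 0 < p by lra.
have Ds0 : 0 < D * sigma by rewrite mulr_gt0.
have qm0 : 0 < 1 - q by lra.
exists ((D * sigma) `^ p / (1 - q)).
  by rewrite divr_gt0// powR_gt0.
move=> s eps eps0.
pose B i := [set x | 2 ^+ (s + i) * eps < `|dyadic_maximal (s + i).+1 x|].
have mB i : measurable (B i).
  rewrite -[B i]setTI; apply: measurable_fun_ltr => //.
  by have [] := bounded_measurable_norm (bounded_dyadic_maximal (s + i).+1).
exists (\bigcup_i B i); first exact: bigcup_measurable.
split.
  move=> x k sk kx.
  have k0 : (0 < k)%N by apply: leq_trans sk; rewrite expn_gt0.
  have /andP[t1 t2] := trunc_log_bounds (isT : 1 < 2)%N k0.
  set t := trunc_log 2 k in t1 t2.
  have st : (s <= t)%N.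
    by rewrite -ltnS -(@ltn_exp2l 2)//; exact: leq_ltn_trans t2.
  exists (t - s)%N => //; rewrite /B subnKC// /mkset.
  rewrite ger0_norm ?dyadic_maximal_ge0//.
  apply: (@lt_le_trans _ _ `|S k x|).
    apply: le_lt_trans kx; rewrite ler_wpM2r ?(ltW eps0)//.
    by rewrite -natrX ler_nat.
  by apply: birkhoff_sum_le_dyadic_maximal; exact: ltnW.
pose K := (D * sigma) `^ p * eps `^ (- p) * q ^+ s.
have K0 : 0 <= K by rewrite !mulr_ge0 ?powR_ge0 ?exprn_ge0 ?ltW.
have muB i : (mu (B i) <= (K * q ^+ i)%:E)%E.
  have l0 : 0 < 2 ^+ (s + i) * eps by rewrite mulr_gt0// exprn_gt0.
  apply: (le_trans (lpnorm_markov mu p0 l0 (bounded_dyadic_maximal _))).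
  rewrite lee_fin.
  apply: (@le_trans _ _ ((D * sigma / eps * (sigma / 2) ^+ (s + i)) `^ p)).
    apply: ge0_ler_powR; rewrite ?nnegrE ?(ltW p0)//.
    - by rewrite divr_ge0 ?lpnorm_ge0 ?(ltW l0).
    - by rewrite mulr_ge0 ?exprn_ge0 ?divr_ge0 ?(ltW Ds0) ?(ltW eps0) ?(ltW s0).
    rewrite ler_pdivrMr//; apply: (le_trans (HD _)).
    rewrite expr_div_n exprS le_eqVlt; apply/orP; left; apply/eqP; field.
    by rewrite ?expf_neq0 ?gt_eqF ?exprn_gt0.
  have sd0 : 0 <= sigma / 2 by rewrite divr_ge0 ?(ltW s0).
  rewrite (@powRM _ (D * sigma / eps)) ?exprn_ge0 ?divr_ge0 ?(ltW Ds0) ?(ltW eps0) ?(ltW s0)//.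
  rewrite (@powRM _ (D * sigma)) ?invr_ge0 ?(ltW Ds0) ?(ltW eps0)//.
  have -> : eps^-1 `^ p = eps `^ (- p).
    by rewrite -powR_inv1 ?(ltW eps0)// -powRrM mulN1r.
  have -> : ((sigma / 2) ^+ (s + i)) `^ p = q ^+ (s + i).
    by rewrite -powR_mulrn// powRAC sq powR_mulrn// ltW.
  by rewrite exprD mulrA.
apply: (@le_trans _ _ (\sum_(0 <= i <oo) mu (B i))%E).
  apply: measure_sigma_subadditive => //; exact: bigcup_measurable.
apply: lime_le; first exact: is_cvg_nneseries.
apply: nearW => m.
apply: (@le_trans _ _ (\sum_(0 <= i < m) (K * q ^+ i)%:E)%E).
  by apply: lee_sum => i _; exact: muB.
rewrite sumEFin lee_fin -mulr_sumr big_mkord.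
have -> : (D * sigma) `^ p / (1 - q) * eps `^ (- p) * q ^+ s = K * (1 - q)^-1.
  by rewrite /K; ring.
by rewrite ler_wpM2l// geometric_sum_le// ltW.
Qed.

End maximal_function.

Lemma ae_le_measure {R : realType} {d} {M : measurableType d}
    (mu : probability M R) (A B : set M) : measurable A -> measurable B ->
  {ae mu, forall x, A x -> B x} -> (mu A <= mu B)%E.
Proof.
move=> mA mB [N [mN N0 AB]].
apply: (@le_trans _ _ (mu (B `|` N))).
  apply: le_measure; rewrite ?inE//; first exact: measurableU.
  move=> x Ax; have [Bx|nBx] := pselect (B x); first by left.
  by right; apply: AB => H; exact: nBx (H Ax).
apply: (le_trans (measureU2 mu mB mN)).
by rewrite [X in (_ + X)%E](_ : _ = 0%E) ?adde0.
Qed.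

(** * Bounded versions of the observable and of its conditional expectations *)

Section transfer_to_bounded_versions.
Context {R : realType} {d} {M : measurableType d}.
Variable mu : probability M R.
Implicit Types (X Y : M -> R).

(** Truncate X at an essential bound. *)
Lemma Lfun_infty_bounded_version X : X \in Lfun mu +oo%E ->
  measurable_fun setT X /\
  exists2 Y, bounded_measurable Y & {ae mu, forall x, X x = Y x}.
Proof.
move=> LX.
have mX : measurable_fun setT X.
  by have := sub_Lfun_mfun LX; rewrite inE.
split => //.
have : ('N[mu]_+oo[EFin \o X] < +oo)%E.
  by have := sub_Lfun_finLfun LX; rewrite inE.
have mu1 : (0 < mu setT)%E.
  by rewrite [X in (_ < X)%E](_ : _ = 1%E) ?lte01//; exact: probability_setT.
rewrite unlock/= mu1 => fin.
have ae := ess_sup_inf.ess_sup_ge mu (abse \o (EFin \o X)).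
have [c Xc] : exists c : R, {ae mu, forall x, `|X x| <= c}.
  move: fin ae; case: (ess_sup_inf.ess_sup _ _) => [c||]//= _ H.
    by exists c; apply: filterS H => x; rewrite lee_fin.
  by exists 0; apply: filterS H => x.
exists (fun x => Num.max (- `|c|) (Num.min `|c| (X x))).
  split.
    apply: measurable_maxr; first exact: measurable_cst.
    by apply: measurable_minr; first exact: measurable_cst.
  exists `|c| => x; have c0 := normr_ge0 c; rewrite ler_norml; apply/andP; split.
    by rewrite le_max lexx.
  by rewrite ge_max ge_min lexx/= andbT; lra.
apply: filterS Xc => x Xc; have := le_trans Xc (ler_norm c).
by rewrite ler_norml => /andP[h1 h2]; rewrite min_r// max_r.
Qed.

Lemma ae_comp (g : M -> M) (P : M -> Prop) : measurable_fun setT g ->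
  (forall A, measurable A -> mu (g @^-1` A) = mu A) ->
  {ae mu, forall x, P x} -> {ae mu, forall x, P (g x)}.
Proof.
move=> mg pg [N [mN N0 PN]]; exists (g @^-1` N); split.
- by rewrite -[_ @^-1` _]setTI; exact: mg.
- by rewrite -N0; exact: pg.
- by move=> x nPx; apply: PN.
Qed.

Lemma lpnorm_le_Lnorm p X Y (b : R) : 0 < p -> measurable_fun setT X ->
  bounded_measurable Y -> {ae mu, forall x, X x = Y x} ->
  ('N[mu]_p%:E[EFin \o X] <= b%:E)%E -> lpnorm mu p Y <= b.
Proof.
move=> p0 mX bY XY; rewrite -lee_fin -LnormE//.
apply: le_trans; rewrite unlock/= le_eqVlt; apply/orP; left; apply/eqP.
congr (_ `^ _)%E; apply: ae_eq_integral => //.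
- by apply/measurable_EFinP; have [] := bounded_measurable_powR (ltW p0) bY.
- apply/measurable_EFinP; apply: (measurableT_comp (measurable_powR p)).
  exact: measurableT_comp.
- by apply: filterS XY => x /= -> _.
Qed.

End transfer_to_bounded_versions.

Section invertible_process.
Context {R : realType} {d} {M : measurableType d}.
Variable mu : probability M R.
Variables (f finv : M -> M) (F0 : set (set M)) (phi : M -> R).
Hypothesis hf : invertible_measure_preserving mu f finv.
Hypothesis sF : sub_sigma_algebra_of F0.
Hypothesis mphi : measurable_fun setT phi.
Hypothesis phi0 : (\int[mu]_x (phi x)%:E = 0)%E.
Variable phi' : M -> R.
Hypothesis bphi' : bounded_measurable phi'.
Hypothesis phiE : {ae mu, forall x, phi x = phi' x}.

Let mf : measurable_fun setT f. Proof. by case: hf. Qed.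
Let pf A : measurable A -> mu (f @^-1` A) = mu A.
Proof. by case: hf => _ _ _ _; exact. Qed.

Lemma iter_cancel k : cancel (iter k f) (iter k finv).
Proof.
have [fK _ _ _ _] := hf.
by elim: k => [//|k IH] x; rewrite iterS iterSr IH fK.
Qed.

Lemma preserving_inverse (A : set M) : measurable A -> mu (finv @^-1` A) = mu A.
Proof.
have [fK _ _ mfi _] := hf; move=> mA.
rewrite -(pf (A := finv @^-1` A)); last by rewrite -[_ @^-1` _]setTI; exact: mfi.
by congr (mu _); apply/seteqP; split=> x /=; rewrite fK.
Qed.

(** Testing the conditional expectation of phi o f^-k against h and composing
    with f^k expresses the test through phi and h o f^k, without the inverse
    map. *)
Lemma past_version k : exists Y : M -> R,
  [/\ bounded_measurable (Y : g_sigma_algebraType F0 -> R),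
    (forall h : M -> R, bounded_measurable (h : g_sigma_algebraType F0 -> R) ->
      mean mu (fun x => Y x * h x) = mean mu (fun x => phi' x * h (iter k f x))) &
    forall p b : R, 0 < p ->
      ('N[mu]_p%:E[EFin \o cond_exp mu F0 (phi \o iter k finv)] <= b%:E)%E ->
      lpnorm mu p Y <= b].
Proof.
have [_ _ _ mfi _] := hf.
have mfk := measurable_iter mfi k.
have pfk := preserving_iter mfi preserving_inverse k.
have bX := bounded_measurable_comp mfk bphi'.
have aeX : {ae mu, forall x, (phi \o iter k finv) x = phi' (iter k finv x)}.
  exact: (ae_comp (P := fun x => phi x = phi' x)).
have mX : measurable_fun setT (phi \o iter k finv) by exact: measurableT_comp.
have [Y [aY mC CY Yh]] := bounded_cond_exp sF mX bX aeX.
have bY := sub_sigma_bounded_measurable sF aY.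
exists Y; split => //.
  move=> h ah; rewrite Yh//; have bh := sub_sigma_bounded_measurable sF ah.
  rewrite -(mean_iter mf pf k); last exact: bounded_measurableM.
  by apply: eq_mean => x; rewrite iter_cancel.
by move=> p b p0; exact: lpnorm_le_Lnorm.
Qed.

(** The counterpart of [past_version] for positive times; here it is the
    distance to phi o f^k that is controlled. *)
Lemma future_version k : exists Y : M -> R,
  [/\ bounded_measurable (Y : g_sigma_algebraType F0 -> R),
    (forall h : M -> R, bounded_measurable (h : g_sigma_algebraType F0 -> R) ->
      mean mu (fun x => Y x * h x) = mean mu (fun x => phi' (iter k f x) * h x)) &
    forall p b : R, 0 < p ->
      ('N[mu]_p%:E[EFin \o (cond_exp mu F0 (phi \o iter k f) \- (phi \o iter k f))%R]
        <= b%:E)%E ->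
      lpnorm mu p (fun x => Y x - phi' (iter k f x)) <= b].
Proof.
have mfk := measurable_iter mf k.
have bX := bounded_measurable_comp mfk bphi'.
have aeX : {ae mu, forall x, (phi \o iter k f) x = phi' (iter k f x)}.
  by apply: (ae_comp (P := fun x => phi x = phi' x)) => //; exact: preserving_iter.
have mX : measurable_fun setT (phi \o iter k f) by exact: measurableT_comp.
have [Y [aY mC CY Yh]] := bounded_cond_exp sF mX bX aeX.
have bY := sub_sigma_bounded_measurable sF aY.
exists Y; split => //.
move=> p b p0; apply: lpnorm_le_Lnorm => //.
- exact: measurable_funB.
- exact: bounded_measurableB.
- by apply: filterS2 CY aeX => x /= -> ->.
Qed.

Lemma measurable_deviation n : measurable_fun setT (deviation mu f phi n).
Proof.
have mi j : measurable_fun setT (fun x => phi (iter j f x)).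
  exact: measurableT_comp mphi (measurable_iter mf j).
apply: measurableT_comp => //; apply: measurable_funB => //.
apply: measurable_funM => //.
elim: n => [|n IH].
  by under eq_fun do rewrite big_ord0; exact: measurable_cst.
by under eq_fun do rewrite big_ord_recr/=; exact: measurable_funD.
Qed.

Lemma deviation_ae : {ae mu, forall x, forall n,
  deviation mu f phi n x = n%:R^-1 * `|birkhoff_sum f phi' n x|}.
Proof.
have : {ae mu, forall x, forall j, phi (iter j f x) = phi' (iter j f x)}.
  apply: ae_foralln => j.
  apply: (ae_comp (P := fun x => phi x = phi' x)) => //; first exact: measurable_iter.
  exact: preserving_iter.
apply: filterS => x H n.
rewrite /deviation /Rintegral phi0/= subr0 /birkhoff_average normrM.
rewrite ger0_norm ?invr_ge0//; congr (_ * `|_|).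
by apply: eq_bigr => j _.
Qed.

Lemma LD_le eps n : (1 <= n)%N ->
  (LD mu f phi eps n <= mu [set x | (n%:R * eps < `|birkhoff_sum f phi' n x|)%R])%E.
Proof.
move=> n1; apply: ae_le_measure.
- rewrite -[X in measurable X]setTI; apply: measurable_fun_ltr => //.
  exact: measurable_deviation.
- rewrite -[X in measurable X]setTI; apply: measurable_fun_ltr => //.
  by have [] := bounded_measurable_norm (bounded_birkhoff_sum mf n bphi').
- apply: filterS deviation_ae => x H; rewrite /= H.
  by rewrite mulrC ltr_pdivlMr ?ltr0n// mulrC.
Qed.

(** The supremum exceeds eps exactly when one of the deviations does, which also
    shows that the event is measurable. *)
Lemma MLD_le eps n B : (1 <= n)%N -> measurable B ->
  (forall x k, (n <= k)%N -> k%:R * eps < `|birkhoff_sum f phi' k x| -> B x) ->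
  (MLD mu f phi eps n <= mu B)%E.
Proof.
move=> n1 mB HB; rewrite /MLD.
have -> : [set x | (eps%:E < ereal_sup
    [set (deviation mu f phi k x)%:E | k in [set k | (n <= k)%N]])%E] =
    \bigcup_(k in [set k | (n <= k)%N]) [set x | eps < deviation mu f phi k x].
  apply/seteqP; split => x /=.
    by move=> /ereal_sup_gt[_ [k nk <-]]; rewrite lte_fin => ek; exists k.
  move=> [k nk ek]; apply: (@lt_le_trans _ _ (deviation mu f phi k x)%:E).
    by rewrite lte_fin.
  by apply: ereal_sup_ubound; exists k.
apply: ae_le_measure => //.
- apply: bigcup_measurable => k _.
  rewrite -[X in measurable X]setTI; apply: measurable_fun_ltr => //.
  exact: measurable_deviation.
- apply: filterS deviation_ae => x H [k nk]; rewrite /= H => ek.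
  apply: (HB x k nk).
  have k0 : 0 < k%:R :> R by rewrite ltr0n (leq_trans n1).
  by move: ek; rewrite mulrC ltr_pdivlMr// mulrC.
Qed.

End invertible_process.

(** * Large deviations and maximal large deviations *)

Lemma scale_error_le {R : realType} {d} {M : measurableType d}
    (mu : probability M R) (f : M -> M) (phi : M -> R) (past future : nat -> M -> R)
    (p b c : R) (K : nat) :
  lpnorm mu p (past K) <= b ->
  lpnorm mu p (fun x => future K x - phi (iter K f x)) <= b -> 2 * b <= c ->
  scale_error mu f phi past future p K <= c.
Proof. by rewrite /scale_error; lra. Qed.

Unset Implicit Arguments.

Theorem theorem3p1 (R : realType) (d : measure_display) (M : measurableType d)
    (mu : probability M R) (f finv : M -> M) (F0 : set (set M)) (phi : M -> R)
    (hf : invertible_measure_preserving mu f finv)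
    (hF0 : sub_sigma_algebra_of F0)
    (hfF0 : forall A, F0 A -> F0 (f @^-1` A))
    (hphi : phi \in Lfun mu +oo%E)
    (hphi0 : (\int[mu]_x (phi x)%:E = 0)%E) :
  (forall C tau omega : R, 0 < C -> 0 < tau -> 0 < omega <= 1 ->
     (forall (p : R) (n : nat), 1 <= p -> (1 <= n)%N ->
        ('N[mu]_p%:E[EFin \o cond_exp mu F0 (phi \o iter n finv)]
           <= (C * expR (- (tau / p * n%:R `^ omega)))%:E)%E /\
        ('N[mu]_p%:E[EFin \o (cond_exp mu F0 (phi \o iter n f)
                               \- (phi \o iter n f))%R]
           <= (C * expR (- (tau / p * n%:R `^ omega)))%:E)%E) ->
     exists2 tau' : R, 0 < tau' &
       forall (n : nat) (eps : R), (1 <= n)%N -> 0 < eps ->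
         (LD mu f phi eps n <=
            (2 * expR (- (tau' * n%:R `^ (omega / 2) * eps `^ omega)))%:E)%E)
  /\
  (forall C beta p : R, 0 < C -> 0 < beta -> Num.max 2 (2 * beta) < p ->
     (forall n : nat, (1 <= n)%N ->
        ('N[mu]_p%:E[EFin \o cond_exp mu F0 (phi \o iter n finv)]
           <= (C * n%:R `^ (- (beta / p)))%:E)%E /\
        ('N[mu]_p%:E[EFin \o (cond_exp mu F0 (phi \o iter n f)
                               \- (phi \o iter n f))%R]
           <= (C * n%:R `^ (- (beta / p)))%:E)%E) ->
     exists2 K : R, 0 < K &
       forall (n : nat) (eps : R), (1 <= n)%N -> 0 < eps ->
         (MLD mu f phi eps n <=
            (K * eps `^ (- p) * n%:R `^ (- beta))%:E)%E).
Proof.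
have [fK fiK mf mfi pf] := hf.
have [mphi [phi' bphi phiE]] := Lfun_infty_bounded_version hphi.
have /choice[past Hpast] := past_version hf hF0 mphi bphi phiE.
have /choice[future Hfuture] :=
  future_version hf hF0 mphi bphi phiE.
have apast k := let: And3 a _ _ := Hpast k in a.
have afuture k := let: And3 a _ _ := Hfuture k in a.
have past_mean k := let: And3 _ a _ := Hpast k in a.
have future_mean k := let: And3 _ a _ := Hfuture k in a.
have past_norm k := let: And3 _ _ a := Hpast k in a.
have future_norm k := let: And3 _ _ a := Hfuture k in a.
have [b Hb] := proj2 bphi.
have b0 : 0 <= b by apply: le_trans (Hb point).
have moments := @lpnorm_birkhoff_sum_geometric R d M mu f F0 mf pf hF0 hfF0
  phi' past future bphi apast afuture past_mean future_mean.
have bS n : bounded_measurable (birkhoff_sum f phi' n).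
  exact: bounded_birkhoff_sum.
have Cr0 := @rio_constant_gt0 R.
have s2 := @sqrt2_le R.
have s20 : 0 <= Num.sqrt 2 :> R by exact: sqrtr_ge0.
split.
- move=> C tau omega C0 t0 /andP[ o0 o1] H.
  pose A : R := (omega * tau)^-1 `^ omega^-1.
  have A0 : 0 < A by rewrite powR_gt0// invr_gt0 mulr_gt0.
  pose B := b + 2 * (C * A).
  have CA0 : 0 < C * A by rewrite mulr_gt0.
  have B0 : 0 < B by rewrite /B; lra.
  (* 28 is 7 times the bound 4 of the geometric series of ratio sqrt 2 / 2. *)
  pose c := 28 * B * (Num.sqrt rio_constant + 1).
  have sr0 : 0 <= Num.sqrt rio_constant :> R by exact: sqrtr_ge0.
  have c0 : 0 < c by rewrite /c !mulr_gt0//; lra.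
  have HS K n : (0 < K)%N -> 2 < K%:R `^ omega ->
      lpnorm mu (K%:R `^ omega) (birkhoff_sum f phi' n) <= c * K%:R * Num.sqrt n%:R.
    move=> K0; set p := K%:R `^ omega => p2.
    have K1 : 1 <= K%:R :> R by rewrite ler1n.
    have p0 : 0 < p by lra.
    have p1 : 1 <= p by lra.
    have half : 0 < (2^-1 : R) <= 1 by lra.
    have phiB : lpnorm mu p phi' <= B.
      by apply: (@le_trans _ _ b); [exact: (lpnorm_le_bound mu p0 bphi Hb)|rewrite /B; lra].
    have err i : scale_error mu f phi' past future p (K * 2 ^ i) <= B * 2^-1 ^+ i.
      have k1 : (1 <= K * 2 ^ i)%N by rewrite muln_gt0 K0 expn_gt0.
      have [H1 H2] := H p _ p1 k1.
      apply: (scale_error_le (past_norm _ _ _ p0 H1)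
        (future_norm _ _ _ p0 H2)).
      (* As p = K ^ omega, the first scale cancels from the exponent. *)
      have -> : tau / p * (K * 2 ^ i)%:R `^ omega = tau * (2 ^+ i) `^ omega.
        rewrite natrM natrX powRM ?exprn_ge0// -/p; field.
        by rewrite gt_eqF.
      have u0 : 0 < 2 ^+ i :> R by rewrite exprn_gt0.
      have := stretched_exp_decay o0 t0 u0; rewrite -/A => D.
      rewrite exprVn mulrA; apply: (@le_trans _ _ (2 * C * (A * (2 ^+ i)^-1))).
        by rewrite ler_wpM2l// mulr_ge0// ltW.
      rewrite mulrA ler_wpM2r ?invr_ge0 ?(ltW u0)//.
      by rewrite /B -[2 * C * A]mulrA; lra.
    (* Any number r of scales with n <= K 2^(r+1) will do; r = n is one. *)
    have nK : (n <= K * 2 ^ n.+1)%N.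
      have := ltn_expl n.+1 (isT : 1 < 2)%N.
      move=> h; apply: (leq_trans (leqnSn n)); apply: (leq_trans (ltnW h)).
      by rewrite leq_pmull.
    have := moments p K n n B 2^-1 p2 K0 half phiB err nK.
    move=> /le_trans; apply.
    have l0 : 0 <= Num.sqrt 2 * 2^-1 :> R by rewrite mulr_ge0.
    have l1 : Num.sqrt 2 * 2^-1 < 1 :> R by lra.
    have geo : \sum_(i < n.+1) (Num.sqrt 2 * 2^-1) ^+ i <= 4 :> R.
      apply: (le_trans (geometric_sum_le n.+1 l0 l1)).
      have d0 : 0 < 1 - Num.sqrt 2 * 2^-1 :> R by lra.
      by rewrite -[leLHS]mul1r ler_pdivrMr//; lra.
    have sK0 : 0 <= Num.sqrt K%:R :> R by exact: sqrtr_ge0.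
    have sn0 : 0 <= Num.sqrt n%:R :> R by exact: sqrtr_ge0.
    have sKK : Num.sqrt K%:R * Num.sqrt K%:R = K%:R :> R.
      by rewrite -expr2 sqr_sqrtr.
    have mcK : martingale_constant p <= (Num.sqrt rio_constant + 1) * Num.sqrt K%:R.
      have pK : p <= K%:R by exact: ler1_powR.
      have : Num.sqrt p <= Num.sqrt K%:R by rewrite ler_wsqrtr.
      have : Num.sqrt 1 <= Num.sqrt K%:R :> R by rewrite ler_wsqrtr.
      rewrite sqrtr1 /martingale_constant sqrtrM ?(ltW Cr0)// => h1 h2.
      have : Num.sqrt rio_constant * Num.sqrt p <=
          Num.sqrt rio_constant * Num.sqrt K%:R by rewrite ler_wpM2l.
      by lra.
    have mc0 : 0 <= martingale_constant p.
      by apply: le_trans (martingale_constant_ge1 p).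
    rewrite sqrtrM//.
    have -> : c * K%:R * Num.sqrt n%:R =
        7 * ((Num.sqrt rio_constant + 1) * Num.sqrt K%:R) * B *
        (Num.sqrt n%:R * Num.sqrt K%:R) * 4.
      transitivity (c * (Num.sqrt K%:R * Num.sqrt K%:R) * Num.sqrt n%:R).
        by rewrite sKK.
      by rewrite /c; ring.
    apply: ler_pM => //.
    + by rewrite mulr_ge0 ?mulr_ge0// ltW.
    + by apply: sumr_ge0 => i _; rewrite exprn_ge0.
    rewrite ler_wpM2r ?mulr_ge0// ler_wpM2r ?(ltW B0)// ler_wpM2l//.
  have oo : 0 < omega <= 1 by rewrite o0.
  have [tau' tau'0 Htau] := deviation_of_moments oo c0 bS HS.
  exists tau' => // n eps n1 eps0.
  exact: le_trans (LD_le hf mphi hphi0 bphi phiE eps n1) (Htau n eps n1 eps0).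
- move=> C beta p C0 be0; rewrite gt_max => /andP[p2 pb] H.
  have p0 : 0 < p by lra.
  have p1 : 1 <= p by lra.
  have pn0 : p != 0 by rewrite gt_eqF.
  have one_powR (x : R) : 1 `^ x = 1 :> R by rewrite powR1.
  pose theta : R := 2 `^ (- (beta / p)).
  have bp0 : 0 < beta / p by rewrite divr_gt0.
  have th0 : 0 < theta by exact: powR_gt0.
  have th1 : theta <= 1.
    by rewrite -(powRr0 2) ler_powR ?oppr_le0 ?(ltW bp0)// ler1n.
  pose B := b + 2 * C.
  have B0 : 0 < B by rewrite /B; lra.
  have phiB : lpnorm mu p phi' <= B.
    by apply: (@le_trans _ _ b); [exact: (lpnorm_le_bound mu p0 bphi Hb)|rewrite /B; lra].
  have err i : scale_error mu f phi' past future p (1 * 2 ^ i) <= B * theta ^+ i.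
    rewrite mul1n.
    have k1 : (1 <= 2 ^ i)%N by rewrite expn_gt0.
    have [H1 H2] := H _ k1.
    apply: (scale_error_le (past_norm _ _ _ p0 H1)
      (future_norm _ _ _ p0 H2)).
    have -> : (2 ^ i)%:R `^ (- (beta / p)) = theta ^+ i.
      by rewrite natrX -powR_mulrn// powRAC powR_mulrn// powR_ge0.
    rewrite mulrA ler_wpM2r ?exprn_ge0 ?(ltW th0)//.
    by rewrite /B; lra.
  pose lambda := Num.sqrt 2 * theta.
  have lE : lambda = 2 `^ (2^-1 - beta / p).
    by rewrite /lambda -powR12_sqrt// -powRD// pnatr_eq0 implybT.
  have l1 : 1 < lambda.
    rewrite lE -[X in X < _](one_powR (2^-1 - beta / p)).
    have bph : beta / p < 2^-1 by rewrite ltr_pdivrMr//; lra.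
    by rewrite gt0_ltr_powR ?nnegrE// ?ltr1n//; lra.
  (* The growth rate of the norms: sigma ^ r = n ^ (1 - beta / p) for n = 2^r. *)
  pose sigma := 2 * theta.
  have sg0 : 0 < sigma by rewrite mulr_gt0.
  have sqrtl : Num.sqrt 2 * lambda = sigma.
    by rewrite /lambda mulrA -expr2 sqr_sqrtr.
  pose C' := 7 * martingale_constant p * B * (lambda / (lambda - 1)).
  have mc0 : 0 <= martingale_constant p.
    by apply: le_trans (martingale_constant_ge1 p).
  have HS r : lpnorm mu p (birkhoff_sum f phi' (2 ^ r)) <= C' * sigma ^+ r.
    have nK : (2 ^ r <= 1 * 2 ^ r.+1)%N by rewrite mul1n leq_exp2l.
    have th01 : 0 < theta <= 1 by rewrite th0.
    have := moments p 1%N (2 ^ r)%N r B theta p2 isT th01 phiB err nK.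
    move=> /le_trans; apply.
    rewrite mulr1 -/lambda.
    have -> : Num.sqrt (2 ^ r)%:R = Num.sqrt 2 ^+ r :> R.
      by rewrite natrX sqrt_pow2.
    apply: (@le_trans _ _ (7 * martingale_constant p * B * Num.sqrt 2 ^+ r *
        (lambda ^+ r.+1 / (lambda - 1)))).
      rewrite ler_wpM2l ?geometric_sum_le_last//.
      by rewrite !mulr_ge0 ?exprn_ge0 ?(ltW B0).
    rewrite -sqrtl [(_ * lambda) ^+ r]exprMn /C' exprS le_eqVlt; apply/orP; left; apply/eqP; ring.
  pose q : R := 2 `^ (- beta).
  have q0 : 0 < q by exact: powR_gt0.
  have q1 : q < 1.
    rewrite /q powRN invf_lt1 ?powR_gt0// -[X in X < _](one_powR beta).
    by rewrite gt0_ltr_powR ?nnegrE// ltr1n.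
  have thq : (sigma / 2) `^ p = q.
    rewrite /sigma mulrAC divff// mul1r /theta -powRrM; congr (_ `^ _).
    by field.
  have sp : 2 < sigma `^ p.
    have -> : sigma `^ p = 2 `^ (p - beta).
      rewrite powRD; last by rewrite pnatr_eq0 implybT.
      rewrite -/q -thq -powRM ?divr_ge0 ?(ltW sg0)//; congr (_ `^ _).
      by field.
    have -> : 2 `^ (p - beta) = 2 * 2 `^ (p - beta - 1).
      rewrite mulr_powRB1//; lra.
    rewrite ltr_pMr// -[X in X < _](one_powR (p - beta - 1)).
    by rewrite gt0_ltr_powR ?nnegrE// ?ltr1n//; lra.
  have q01 : 0 < q < 1 by rewrite q0.
  have [K K0 HK] := maximal_deviation mf pf bphi p1 sg0 sp q01 thq HS.
  exists (K * 2 `^ beta); first by rewrite mulr_gt0// powR_gt0.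
  move=> n eps n1 eps0.
  have /andP[s1 sn] := trunc_log_bounds (isT : 1 < 2)%N n1.
  set s := trunc_log 2 n in s1 sn.
  have [E mE [HE muE]] := HK s eps eps0.
  have HE' x k : (n <= k)%N -> k%:R * eps < `|birkhoff_sum f phi' k x| -> E x.
    by move=> nk; apply: HE; exact: leq_trans nk.
  apply: (le_trans (MLD_le hf mphi hphi0 phiE n1 mE HE')).
  apply: (le_trans muE); rewrite lee_fin.
  have -> : K * 2 `^ beta * eps `^ (- p) * n%:R `^ (- beta) =
    K * eps `^ (- p) * (2 `^ beta * n%:R `^ (- beta)) by ring.
  rewrite ler_wpM2l//; first by rewrite mulr_ge0 ?powR_ge0// ltW.
  have n0 : 0 < n%:R `^ beta :> R by rewrite powR_gt0// ltr0n.
  rewrite [n%:R `^ _]powRN ler_pdivlMr//.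
  have -> : q ^+ s = ((2 ^+ s) `^ beta)^-1.
    by rewrite -powRN -powR_mulrn ?(ltW q0)// /q -powR_mulrn// powRAC.
  rewrite mulrC ler_pdivrMr ?powR_gt0 ?exprn_gt0//.
  rewrite -powRM ?exprn_ge0// ge0_ler_powR ?nnegrE ?mulr_ge0 ?exprn_ge0 ?(ltW be0)//.
  by rewrite -exprS -natrX ler_nat ltnW.
Qed.
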